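(* The structure $(\mathcal W_{ptW},\le_{ptW},\widehat{\overline{\sqcap}},\sqcup,\Rrightarrow,1,\infty)$ is a Brouwer algebra; that is, $(\mathcal W_{ptW},\le_{ptW})$ is a bounded lattice with infimum $f\,\widehat{\overline{\sqcap}}\,g=\widehat{\overline f}\sqcap\widehat{\overline g}$, supremum $f\sqcup g$, bottom $1$ and top $\infty$, $\Rrightarrow$ is monotone in its second and antitone in its first argument, and for all $f,g,h$: $(g\Rrightarrow f)\le_{ptW}h\iff f\le_{ptW}g\sqcup h$.
   Context: A represented space $(X,\delta_X)$ is a set with a surjective partial map $\delta_X:\subseteq\mathbb{N}^\mathbb{N}\to X$; problems are partial multi-valued maps between represented spaces; $F$ realizes $f:\subseteq X\rightrightarrows Y$ if $\delta_YF(p)\in f(\delta_X(p))$ for all $p\in\mathrm{dom}(f\circ\delta_X)$. Pairing $\langle p,q\rangle(2n)=p(n)$, $\langle p,q\rangle(2n+1)=q(n)$. $f\le_W g$ iff there are computable $H,K$ with $p\mapsto H\langle p,GK(p)\rangle$ realizing $f$ for every realizer $G$ of $g$. A top element $\infty$ is adjoined ($f\le_W\infty$ always, $\infty\le_W f$ only if $f=\infty$) with $f\sqcup\infty=\infty\sqcup f=\infty$, $f\sqcap\infty=\infty\sqcap f=f$, $\overline\infty=\widehat\infty=\infty$. Completion: $p-1$ is the concatenation of $p(0)-1,p(1)-1,\dots$ with $0-1$ the empty word; $\delta_X^\wp(p)=\delta_X(p-1)$ if $p-1\in\mathrm{dom}(\delta_X)$; $\overline X=X\cup\{\bot\}$ with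 $\delta_{\overline X}(p)=\delta_X^\wp(p)$ if defined, $\bot$ otherwise; $\overline f(x)=f(x)$ on $\mathrm{dom}(f)$, $\overline Y$ otherwise. Parallelization $\widehat f((x_n)_n)=\prod_i f(x_i)$ on $\mathrm{dom}(f)^\mathbb{N}$. $f\sqcup g$ maps $(0,x)\mapsto\{0\}\times f(x)$, $(1,u)\mapsto\{1\}\times g(u)$ on $\mathrm{dom}(f)\sqcup\mathrm{dom}(g)$; $(f\sqcap g)(x,u)=f(x)\sqcup g(u)$ on $\mathrm{dom}(f)\times\mathrm{dom}(g)$, with $A\sqcup B=(\{0\}\times A)\cup(\{1\}\times B)$. Multiplicative implication: with $f^r:=\delta_Y^{-1}\circ f\circ\delta_X$ and a G\''odel numbering $\varphi$ of partial computable functions $\subseteq\mathbb{N}^\mathbb{N}\to\mathbb{N}^\mathbb{N}$ (utm and smn), for $f,g\ne\infty$ with $\mathrm{dom}(g)\ne\emptyset$ or $\mathrm{dom}(f)=\emptyset$: $(g\twoheadrightarrow f)(p)=\{\langle n,k,q\rangle:\emptyset\ne\varphi_n\langle q,g^r\circ\varphi_k(p)\rangle\subseteq f^r(p)\}$ (multi-valued composition, maximal domain, $\langle n,k,q\rangle$ a standard encoding); $(g\twoheadrightarrow0)=0$, $(0\twoheadrightarrow f)=\infty$ for $f\not\equiv_W0$, $(\infty\twoheadrightarrow f)=0$, $(g\twoheadrightarrow\infty)=\infty$ for $g\ne\infty$, $0$ being the nowhere defined problem. Parallelized total Weihrauch reducibility: $f\le_{ptW}g:\iff f\le_W\widehat{\overline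 g}$; $\mathcal W_{ptW}$ is the set of its equivalence classes including that of $\infty$, and $1$ is the class of $\mathrm{id}:\mathbb{N}^\mathbb{N}\to\mathbb{N}^\mathbb{N}$. Define $(g\Rrightarrow f):=(\widehat{\overline g}\twoheadrightarrow\widehat{\overline f})$. *)

(* Defs.v *)
From Stdlib Require Import Arith Cantor List.
From Stdlib Require Import Classical ClassicalEpsilon FunctionalExtensionality.

Set Implicit Arguments.
Unset Strict Implicit.
Unset Printing Implicit Defensive.

Definition baire := nat -> nat.

Definition bpair (p q : baire) : baire :=
  fun n => if Nat.even n then p (Nat.div2 n) else q (Nat.div2 n).

Definition bfst (p : baire) : baire := fun n => p (2 * n).
Definition bsnd (p : baire) : baire := fun n => p (2 * n + 1).

Definition bcons (n : nat) (p : baire) : baire :=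
  fun i => match i with 0 => n | S j => p j end.
Definition btail (p : baire) : baire := fun i => p (S i).

(* <p_0, p_1, ...> has p_i (k) at position <i,k>, with Cantor's pairing of
   natural numbers. *)
Definition bseq (ps : nat -> baire) : baire :=
  fun m => let (i, k) := Cantor.of_nat m in ps i k.
Definition bproj (i : nat) (p : baire) : baire :=
  fun k => p (Cantor.to_nat (i, k)).

Definition btriple (n k : nat) (q : baire) : baire := bcons n (bcons k q).

Lemma bfst_bpair p q : bfst (bpair p q) = p.
Proof.
  apply functional_extensionality; intro n. unfold bfst, bpair.
  rewrite Nat.even_mul; simpl Nat.even; cbn [orb].
  now rewrite Nat.div2_double.
Qed.

Lemma bsnd_bpair p q : bsnd (bpair p q) = q.
Proof.
  apply functional_extensionality; intro n. unfold bsnd, bpair.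
  replace (2 * n + 1) with (S (2 * n)) by (rewrite Nat.add_1_r; reflexivity).
  rewrite Nat.even_succ, <- Nat.negb_even, Nat.even_mul; simpl Nat.even;
    cbn [orb negb].
  now rewrite Nat.div2_succ_double.
Qed.

Lemma bproj_bseq i ps : bproj i (bseq ps) = ps i.
Proof.
  apply functional_extensionality; intro k. unfold bproj, bseq.
  now rewrite Cantor.cancel_of_to.
Qed.

Record pfun (A B : Type) := PFun {
  graph :> A -> B -> Prop;
  graph_fun : forall a b b', graph a b -> graph a b' -> b = b'
}.

Definition mdom (A B : Type) (R : A -> B -> Prop) (a : A) : Prop :=
  exists b, R a b.

(* [mcomp S R] is the composition "S after R" with maximal domain
   {a in dom R | R a is included in dom S}. *)
Definition mcomp (A B C : Type) (S : B -> C -> Prop) (R : A -> B -> Prop)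
    (a : A) (c : C) : Prop :=
  (exists b, R a b /\ S b c) /\ (forall b, R a b -> mdom S b).

Definition minv (A B : Type) (R : A -> B -> Prop) (b : B) (a : A) : Prop := R a b.

(* Partial recursive functions relative to an oracle, in the unary
   presentation: tuples of arguments are coded by Cantor's pairing. *)
Inductive code : Type :=
| CZero
| CSucc
| CLeft
| CRight
| COracle
| CPair (a b : code)
| CComp (a b : code)
| CPrec (a b : code)
| CMu (a : code).

(* [eval c p x y]: the program [c] with oracle [p] halts on [x] with value [y]. *)
Fixpoint eval (c : code) (p : baire) (x y : nat) {struct c} : Prop :=
  match c with
  | CZero => y = 0
  | CSucc => y = S x
  | CLeft => y = fst (Cantor.of_nat x)
  | CRight => y = snd (Cantor.of_nat x)
  | COracle => y = p x
  | CPair a b =>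
      exists u v, eval a p x u /\ eval b p x v /\ y = Cantor.to_nat (u, v)
  | CComp a b => exists u, eval b p x u /\ eval a p u y
  | CPrec a b =>
      let (z, n) := Cantor.of_nat x in
      (fix prec (n y : nat) {struct n} : Prop :=
         match n with
         | 0 => eval a p z y
         | S m => exists u, prec m u /\
                    eval b p (Cantor.to_nat (z, Cantor.to_nat (m, u))) y
         end) n y
  | CMu a =>
      eval a p (Cantor.to_nat (x, y)) 0 /\
      forall i, i < y -> exists v, eval a p (Cantor.to_nat (x, i)) (S v)
  end.

(* The domain of a computable function need not be the natural domain of its
   program. *)
Definition computable (F : pfun baire baire) : Prop :=
  exists c, forall p q, F p q -> forall k, eval c p k (q k).

Definition computable_nat2 (s : nat -> nat -> nat) : Prop :=
  exists c, forall p n k, eval c p (Cantor.to_nat (n, k)) (s n k).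

Definition universal (phi : nat -> pfun baire baire) : pfun baire baire :=
  PFun (fun (t q : baire) (q' : baire) (H : phi (t 0) (btail t) q) H' =>
          graph_fun H H').

(* Since computable functions have arbitrary domains, a numbering can only
   reach them up to extension. Numberings with these properties exist by
   Kleene's enumeration theorem relative to an oracle. *)
Record goedel_numbering (phi : nat -> pfun baire baire) : Prop := {
  gn_complete : forall F, computable F ->
    exists n, forall p q, F p q -> phi n p q;
  gn_utm : computable (universal phi);
  gn_smn : exists s, computable_nat2 s /\
    forall n k p q, phi n (bcons k p) q <-> phi (s n k) p q
}.

Record repspace := RepSpace {
  carrier :> Type;
  delta : pfun baire carrier;
  delta_surj : forall x, exists p, delta p x
}.

Definition baire_space : repspace.
Proof.
  unshelve refine (@RepSpace baire (@PFun baire baire (fun p x => x = p) _) _).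
  - intros p x y; congruence.
  - intro x; now exists x.
Defined.

Definition prod_delta (X Y : repspace) (p : baire) (z : X * Y) : Prop :=
  delta X (bfst p) (fst z) /\ delta Y (bsnd p) (snd z).

Definition prod_space (X Y : repspace) : repspace.
Proof.
  unshelve refine (@RepSpace (X * Y) (@PFun _ _ (@prod_delta X Y) _) _).
  - intros p [x y] [x' y'] [Hx Hy] [Hx' Hy']; cbn in *.
    now rewrite (graph_fun Hx Hx'), (graph_fun Hy Hy').
  - intros [x y].
    destruct (delta_surj x) as [p Hp], (delta_surj y) as [q Hq].
    exists (bpair p q); split; cbn.
    + now rewrite bfst_bpair.
    + now rewrite bsnd_bpair.
Defined.

Definition sum_delta (X Y : repspace) (p : baire) (z : X + Y) : Prop :=
  match z with
  | inl x => p 0 = 0 /\ delta X (btail p) x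
  | inr y => p 0 = 1 /\ delta Y (btail p) y
  end.

Definition sum_space (X Y : repspace) : repspace.
Proof.
  unshelve refine (@RepSpace (X + Y) (@PFun _ _ (@sum_delta X Y) _) _).
  - intros p [x|y] [x'|y'] [H Hx] [H' Hx']; try congruence;
      now rewrite (graph_fun Hx Hx').
  - intros [x|y].
    + destruct (delta_surj x) as [p Hp]; now exists (bcons 0 p).
    + destruct (delta_surj y) as [p Hp]; now exists (bcons 1 p).
Defined.

Definition seq_delta (X : repspace) (p : baire) (x : nat -> X) : Prop :=
  forall i, delta X (bproj i p) (x i).

Definition seq_space (X : repspace) : repspace.
Proof.
  unshelve refine (@RepSpace (nat -> X) (@PFun _ _ (@seq_delta X) _) _).
  - intros p x x' H H'; apply functional_extensionality; intro i.
    exact (graph_fun (H i) (H' i)).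
  - intro x.
    exists (bseq (fun i => proj1_sig
      (constructive_indefinite_description _ (delta_surj (x i))))).
    intro i; rewrite bproj_bseq.
    exact (proj2_sig (constructive_indefinite_description _ (delta_surj (x i)))).
Defined.

(* (p(0)-1) (p(1)-1) ... (p(n-1)-1) *)
Definition minus1_word (p : baire) (n : nat) : list nat :=
  flat_map (fun i => match p i with 0 => nil | S a => a :: nil end) (seq 0 n).

(* [minus1 p q]: the word p-1 is infinite and equal to q. *)
Definition minus1 (p q : baire) : Prop :=
  forall k, exists n, nth_error (minus1_word p n) k = Some (q k).

Lemma minus1_word_add p m n :
  exists w, minus1_word p (m + n) = minus1_word p m ++ w.
Proof.
  unfold minus1_word; rewrite seq_app, flat_map_app; eauto.
Qed.

Lemma minus1_word_mono p m n k a : m <= n ->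
  nth_error (minus1_word p m) k = Some a ->
  nth_error (minus1_word p n) k = Some a.
Proof.
  intros Hmn H.
  destruct (minus1_word_add p m (n - m)) as [w Hw].
  rewrite (Nat.add_comm m), Nat.sub_add in Hw by assumption.
  rewrite Hw, nth_error_app1; [assumption|].
  apply nth_error_Some; congruence.
Qed.

Lemma minus1_fun p q q' : minus1 p q -> minus1 p q' -> q = q'.
Proof.
  intros H H'; apply functional_extensionality; intro k.
  destruct (H k) as [n Hn], (H' k) as [n' Hn'].
  apply (minus1_word_mono (Nat.le_max_l n n')) in Hn.
  apply (minus1_word_mono (Nat.le_max_r n n')) in Hn'.
  congruence.
Qed.

Lemma minus1_succ q : minus1 (fun i => S (q i)) q.
Proof.
  intro k; exists (S k).
  assert (E : forall n, minus1_word (fun i => S (q i)) n = map q (seq 0 n)).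
  { intro n; unfold minus1_word; induction (seq 0 n); cbn; congruence. }
  rewrite E, nth_error_map, nth_error_seq.
  now rewrite (proj2 (Nat.ltb_lt k (S k)) (Nat.lt_succ_diag_r k)).
Qed.

Lemma minus1_zero q : ~ minus1 (fun _ => 0) q.
Proof.
  intro H; destruct (H 0) as [n Hn].
  assert (E : minus1_word (fun _ => 0) n = nil).
  { unfold minus1_word; induction (seq 0 n); cbn; auto. }
  rewrite E in Hn; discriminate.
Qed.

Definition wp_delta (X : repspace) (p : baire) (x : X) : Prop :=
  exists q, minus1 p q /\ delta X q x.

(* [None] is the bottom element. *)
Definition completion_delta (X : repspace) (p : baire) (x : option X) : Prop :=
  match x with
  | Some a => wp_delta p a
  | None => ~ exists a : X, wp_delta p a
  end.

Definition completion_space (X : repspace) : repspace.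
Proof.
  unshelve refine (@RepSpace (option X) (@PFun _ _ (@completion_delta X) _) _).
  - intros p [x|] [x'|] H H'; cbn in *; try reflexivity.
    + destruct H as [q [Hq Hx]], H' as [q' [Hq' Hx']].
      rewrite (minus1_fun Hq Hq') in Hx.
      now rewrite (graph_fun Hx Hx').
    + now exfalso; apply H'; exists x.
    + now exfalso; apply H; exists x'.
  - intros [x|].
    + destruct (delta_surj x) as [q Hq].
      exists (fun i => S (q i)), q; split; [apply minus1_succ | assumption].
    + exists (fun _ => 0); intros [a [q [Hq _]]]; exact (minus1_zero Hq).
Defined.

(* The domain of a problem is [mdom], the set of points with a nonempty image. *)
Record problem := Problem {
  src : repspace;
  tgt : repspace;
  app :> src -> tgt -> Prop
}.

Definition realizes (F : pfun baire baire) (f : problem) : Prop :=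
  forall p x, delta (src f) p x -> mdom f x ->
  exists q y, F p q /\ delta (tgt f) q y /\ f x y.

(* p |-> H <p, G (K p)> *)
Definition reduction (H K G : pfun baire baire) : pfun baire baire.
Proof.
  refine (@PFun baire baire
    (fun p q => exists k r, K p k /\ G k r /\ H (bpair p r) q) _).
  intros p q q' (k & r & Hk & Hr & Hq) (k' & r' & Hk' & Hr' & Hq').
  rewrite <- (graph_fun Hk Hk') in Hr'.
  rewrite <- (graph_fun Hr Hr') in Hq'.
  exact (graph_fun Hq Hq').
Defined.

Definition weihrauch (f g : problem) : Prop :=
  exists H K : pfun baire baire, computable H /\ computable K /\
  forall G, realizes G g -> realizes (reduction H K G) f.

(* [None] is the top element. *)
Definition eproblem := option problem.

Definition infty : eproblem := None.

Definition le_W (f g : eproblem) : Prop :=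
  match f, g with
  | _, None => True
  | None, Some _ => False
  | Some f, Some g => weihrauch f g
  end.

Definition zero : problem :=
  @Problem baire_space baire_space (fun _ _ => False).

Definition one : problem :=
  @Problem baire_space baire_space (fun p q => q = p).

Definition completion (f : problem) : problem :=
  @Problem (completion_space (src f)) (completion_space (tgt f))
    (fun x y => forall a, x = Some a -> mdom f a ->
       exists b, y = Some b /\ f a b).

Definition parallelization (f : problem) : problem :=
  @Problem (seq_space (src f)) (seq_space (tgt f))
    (fun x y => forall i, f (x i) (y i)).

Definition coproduct (f g : problem) : problem :=
  @Problem (sum_space (src f) (src g)) (sum_space (tgt f) (tgt g))
    (fun x y => match x, y with
                | inl a, inl b => f a b
                | inr a, inr b => g a b
                | _, _ => False
                end).

Definition inf_problem (f g : problem) : problem :=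
  @Problem (prod_space (src f) (src g)) (sum_space (tgt f) (tgt g))
    (fun x y => mdom f (fst x) /\ mdom g (snd x) /\
                match y with
                | inl b => f (fst x) b
                | inr b => g (snd x) b
                end).

(* f^r = delta_Y^{-1} o f o delta_X *)
Definition rproblem (f : problem) : baire -> baire -> Prop :=
  mcomp (minv (delta (tgt f))) (mcomp f (delta (src f))).

Definition mul_imp_rel (phi : nat -> pfun baire baire) (g f : problem)
    (p t : baire) : Prop :=
  exists n k q, t = btriple n k q /\
    let A := mcomp (fun r s => phi n (bpair q r) s)
                   (mcomp (rproblem g) (phi k)) p in
    (exists s, A s) /\ (forall s, A s -> rproblem f p s).

Definition mul_imp_problem (phi : nat -> pfun baire baire) (g f : problem) :
    problem :=
  @Problem baire_space baire_space (mul_imp_rel phi g f).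

Definition ecompletion (f : eproblem) : eproblem := option_map completion f.
Definition eparallelization (f : eproblem) : eproblem :=
  option_map parallelization f.

Definition esup (f g : eproblem) : eproblem :=
  match f, g with
  | Some f, Some g => Some (coproduct f g)
  | _, _ => infty
  end.

Definition einf (f g : eproblem) : eproblem :=
  match f, g with
  | Some f, Some g => Some (inf_problem f g)
  | None, _ => g
  | _, None => f
  end.

(* The problems equivalent to [zero] are those with empty domain, hence the
   remaining case among proper problems is (0 ->> f) with f not equivalent to
   [zero]. For [f] with empty domain, [mul_imp_problem] has empty domain. *)
Definition mul_imp (phi : nat -> pfun baire baire) (g f : eproblem) : eproblem :=
  match g, f with
  | None, _ => Some zero
  | Some _, None => infty
  | Some g, Some f =>
      if excluded_middle_informative
           ((exists x, mdom g x) \/ ~ (exists x, mdom f x))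
      then Some (mul_imp_problem phi g f)
      else infty
  end.

Definition hatbar (f : eproblem) : eproblem := eparallelization (ecompletion f).

Definition le_ptW (f g : eproblem) : Prop := le_W f (hatbar g).

Definition equiv_ptW (f g : eproblem) : Prop := le_ptW f g /\ le_ptW g f.

Definition ptW_inf (f g : eproblem) : eproblem := einf (hatbar f) (hatbar g).

Definition ptW_imp (phi : nat -> pfun baire baire) (g f : eproblem) : eproblem :=
  mul_imp phi (hatbar g) (hatbar f).

Definition W_ptW := {C : eproblem -> Prop | exists f, C = equiv_ptW f}.

Definition cls (f : eproblem) : W_ptW :=
  exist _ (equiv_ptW f) (ex_intro _ f eq_refl).

Definition deg_le (a b : W_ptW) : Prop :=
  exists f g, proj1_sig a f /\ proj1_sig b g /\ le_ptW f g.

Definition induced (op : W_ptW -> W_ptW -> W_ptW)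
    (op0 : eproblem -> eproblem -> eproblem) : Prop :=
  forall f g, op (cls f) (cls g) = cls (op0 f g).

Record brouwer_algebra (T : Type) (le : T -> T -> Prop)
    (meet join imp : T -> T -> T) (bot top : T) : Prop := {
  ba_refl : forall a, le a a;
  ba_trans : forall a b c, le a b -> le b c -> le a c;
  ba_antisym : forall a b, le a b -> le b a -> a = b;
  ba_meet_l : forall a b, le (meet a b) a;
  ba_meet_r : forall a b, le (meet a b) b;
  ba_meet_glb : forall a b c, le c a -> le c b -> le c (meet a b);
  ba_join_l : forall a b, le a (join a b);
  ba_join_r : forall a b, le b (join a b);
  ba_join_lub : forall a b c, le a c -> le b c -> le (join a b) c;
  ba_bot : forall a, le bot a;
  ba_top : forall a, le a top;
  ba_imp_mono : forall a b c, le b c -> le (imp a b) (imp a c);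
  ba_imp_anti : forall a b c, le a b -> le (imp b c) (imp a c);
  ba_residual : forall f g h, le (imp g f) h <-> le f (join g h)
}.

(* Main.v *)
(* Everything is transferred to relations between names. On names the completed
   parallelization is total, and it is a closure operator because a partial
   computable function becomes total on completions by emitting dummy symbols
   until its next output symbol is known. Moreover the completed
   parallelization of a coproduct is equivalent to the product of the two
   completed parallelizations. The residual law then compares two ways of
   solving f with g and h: a solution of the implication consists of a program
   index for an instance of g and further data, and h may compute this index,
   so a single parallel query to g and h must offer the instances of g for all
   indices. Completion makes this possible although most of them are
   undefined. Monotonicity of the implication follows from the residual law. *)
From Stdlib Require Import Arith Cantor List Lia.
From Stdlib Require Import Classical ClassicalEpsilon FunctionalExtensionality.
From Stdlib Require Import PropExtensionality ProofIrrelevance.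
Require Import Defs.

Set Implicit Arguments.
Unset Strict Implicit.
Unset Printing Implicit Defensive.

Opaque Cantor.to_nat Cantor.of_nat.

(** * Recursive functionals *)

(** Dummy symbols can be emitted only by a procedure that knows, after finitely many steps, whether
    the next value has been found. The relation [eval] counts no steps, so every program is first
    converted into a total recursive function of an additional stage argument. A second obstacle is
    that computable functions have arbitrary domains and that [phi] reaches them only up to
    extension: nothing can be inferred from a program being undefined. For this reason [crel] and
    [wr] only assert that certain answers are obtained. Totality on names then pays off: a query may
    be nonsensical, because an answer to it exists anyway and can be ignored. *)

Definition pr (a b : nat) : nat := Cantor.to_nat (a, b).
Definition pi1 (n : nat) : nat := fst (Cantor.of_nat n).
Definition pi2 (n : nat) : nat := snd (Cantor.of_nat n).

Lemma pi1_pr a b : pi1 (pr a b) = a.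
Proof. unfold pi1, pr; now rewrite Cantor.cancel_of_to. Qed.

Lemma pi2_pr a b : pi2 (pr a b) = b.
Proof. unfold pi2, pr; now rewrite Cantor.cancel_of_to. Qed.

Lemma pr_pi n : pr (pi1 n) (pi2 n) = n.
Proof.
  unfold pr, pi1, pi2; rewrite <- surjective_pairing.
  apply Cantor.cancel_to_of.
Qed.

Lemma eval_prec_0 a b p z y :
  eval (CPrec a b) p (pr z 0) y <-> eval a p z y.
Proof. unfold pr; cbn [eval]; now rewrite Cantor.cancel_of_to. Qed.

Lemma eval_prec_S a b p z m y :
  eval (CPrec a b) p (pr z (S m)) y <->
  exists u, eval (CPrec a b) p (pr z m) u /\ eval b p (pr z (pr m u)) y.
Proof. unfold pr; cbn [eval]; now rewrite !Cantor.cancel_of_to. Qed.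

Lemma eval_fun c p x y y' : eval c p x y -> eval c p x y' -> y = y'.
Proof.
  revert x y y'; induction c; intros x y y' H H'.
  1-5: cbn in *; congruence.
  - destruct H as (u & v & Hu & Hv & ->), H' as (u' & v' & Hu' & Hv' & ->).
    now rewrite (IHc1 _ _ _ Hu Hu'), (IHc2 _ _ _ Hv Hv').
  - destruct H as (u & Hu & H), H' as (u' & Hu' & H').
    rewrite (IHc2 _ _ _ Hu Hu') in H; eauto.
  - rewrite <- (pr_pi x) in H, H'.
    revert y y' H H'; induction (pi2 x) as [|m IH]; intros y y' H H'.
    + rewrite eval_prec_0 in H, H'; eauto.
    + rewrite eval_prec_S in H, H'.
      destruct H as (u & Hu & H), H' as (u' & Hu' & H').
      rewrite (IH _ _ Hu Hu') in H; eauto.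
  - destruct H as [H Hlt], H' as [H' Hlt'].
    destruct (Nat.lt_trichotomy y y') as [L|[L|L]]; [|assumption|].
    + destruct (Hlt' _ L) as [v Hv]; discriminate (IHc _ _ _ H Hv).
    + destruct (Hlt _ L) as [v Hv]; discriminate (IHc _ _ _ H' Hv).
Qed.

(** * Closure properties of recursive functionals *)

Definition recursive (f : baire -> baire) : Prop :=
  exists c, forall p n, eval c p n (f p n).

Lemma recursive_const k : recursive (fun _ _ => k).
Proof.
  induction k as [|k [c Hc]].
  - now exists CZero.
  - exists (CComp CSucc c); intros p n; exists k.
    split; [apply Hc | reflexivity].
Qed.

Lemma recursive_id : recursive (fun _ n => n).
Proof.
  exists (CPair CLeft CRight); intros p n.
  exists (pi1 n), (pi2 n); repeat split; symmetry; apply pr_pi.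
Qed.

Lemma recursive_comp f g :
  recursive f -> recursive g -> recursive (fun p n => f p (g p n)).
Proof.
  intros [c Hc] [d Hd]; exists (CComp c d); intros p n; exists (g p n); auto.
Qed.

Lemma recursive_oracle g : recursive g -> recursive (fun p n => p (g p n)).
Proof.
  intro H; refine (recursive_comp (f := fun p => p) _ H).
  now exists COracle.
Qed.

Lemma recursive_S g : recursive g -> recursive (fun p n => S (g p n)).
Proof.
  intro H; refine (recursive_comp (f := fun _ => S) _ H).
  now exists CSucc.
Qed.

Lemma recursive_pi1 g : recursive g -> recursive (fun p n => pi1 (g p n)).
Proof.
  intro H; refine (recursive_comp (f := fun _ => pi1) _ H).
  now exists CLeft.
Qed.

Lemma recursive_pi2 g : recursive g -> recursive (fun p n => pi2 (g p n)).
Proof.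
  intro H; refine (recursive_comp (f := fun _ => pi2) _ H).
  now exists CRight.
Qed.

Lemma recursive_pr f g :
  recursive f -> recursive g -> recursive (fun p n => pr (f p n) (g p n)).
Proof.
  intros [c Hc] [d Hd]; exists (CPair c d); intros p n.
  exists (f p n), (g p n); auto.
Qed.

Lemma recursive_nat_rect a s k :
  recursive a ->
  recursive (fun p x => s p (pi1 x) (pi1 (pi2 x)) (pi2 (pi2 x))) ->
  recursive k ->
  recursive (fun p n =>
    nat_rect (fun _ => nat) (a p n) (fun m u => s p n m u) (k p n)).
Proof.
  intros [ca Ha] [cs Hs] Hk.
  destruct (recursive_pr recursive_id Hk) as [d Hd].
  exists (CComp (CPrec ca cs) d); intros p n.
  exists (pr n (k p n)); split; [apply Hd|].
  induction (k p n) as [|m IH].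
  - now apply eval_prec_0.
  - apply eval_prec_S; eexists; split; [exact IH|].
    specialize (Hs p (pr n (pr m (nat_rect (fun _ => nat) (a p n)
      (fun m u => s p n m u) m)))); cbn beta in Hs.
    rewrite !pi1_pr, !pi2_pr, pi1_pr in Hs; exact Hs.
Qed.

Lemma recursive_uncurry2 f g h :
  recursive (fun p x => f p (pi1 x) (pi2 x)) -> recursive g -> recursive h ->
  recursive (fun p n => f p (g p n) (h p n)).
Proof.
  intros Hf Hg Hh.
  pose proof (recursive_comp Hf (recursive_pr Hg Hh)) as H; cbn beta in H.
  replace (fun p n => f p (g p n) (h p n)) with
    (fun p n => f p (pi1 (pr (g p n) (h p n))) (pi2 (pr (g p n) (h p n)))).
  - exact H.
  - do 2 (apply functional_extensionality; intro).
    now rewrite pi1_pr, pi2_pr.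
Qed.

Lemma recursive_match a b k :
  recursive a -> recursive (fun p x => b p (pi1 x) (pi2 x)) -> recursive k ->
  recursive (fun p n => match k p n with 0 => a p n | S m => b p n m end).
Proof.
  intros Ha Hb Hk.
  pose proof (@recursive_nat_rect a (fun p n m _ => b p n m) k Ha) as H.
  replace (fun p n => match k p n with 0 => a p n | S m => b p n m end)
    with (fun p n => nat_rect (fun _ => nat) (a p n) (fun m _ => b p n m) (k p n)).
  - apply H; [|exact Hk].
    apply (recursive_uncurry2 (f := b)); [exact Hb| |].
    + apply recursive_pi1, recursive_id.
    + apply recursive_pi1, recursive_pi2, recursive_id.
  - do 2 (apply functional_extensionality; intro); now destruct (k _ _).
Qed.

Ltac recursive_step :=
  match goal with
  | H : recursive _ |- _ => exact H
  | |- recursive (fun p n => ?k) => apply (recursive_const k)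
  | |- recursive (fun p n => n) => apply recursive_id
  | |- recursive (fun p n => S (@?g p n)) => apply (@recursive_S g)
  | |- recursive (fun p n => pi1 (@?g p n)) => apply (@recursive_pi1 g)
  | |- recursive (fun p n => pi2 (@?g p n)) => apply (@recursive_pi2 g)
  | |- recursive (fun p n => pr (@?f p n) (@?g p n)) =>
      apply (@recursive_pr f g)
  | |- recursive (fun p n => match @?k p n with 0 => @?a p n
                             | S m => @?b p n m end) =>
      apply (@recursive_match a b k); cbn beta
  | |- recursive (fun p n => nat_rect _ (@?a p n)
         (fun m u => @?s p n m u) (@?k p n)) =>
      apply (@recursive_nat_rect a s k); cbn beta
  | |- recursive (fun p n => p (@?g p n)) => apply (@recursive_oracle g)
  | H : recursive ?f |- recursive (fun p n => ?f p (@?g p n)) =>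
      apply (@recursive_comp f g)
  | H : recursive (fun p x => ?f p (pi1 x) (pi2 x))
    |- recursive (fun p n => ?f p (@?g p n) (@?h p n)) =>
      apply (@recursive_uncurry2 f g h)
  end.

Ltac recursive := repeat recursive_step.

(** * Replacing the oracle by a program *)

(** The new oracle may depend on a parameter [z], so every input [x] becomes [pr z x] and [z] has to
    be threaded through all constructors. Recursion and search put their own argument on the right,
    as in [pr (pr z x) y], whence the reassociation to [pr z (pr x y)] before the body is called. *)
Fixpoint subst_code (o c : code) : code :=
  let L := CLeft in let R := CRight in
  match c with
  | CZero => CZero
  | CSucc => CComp CSucc R
  | CLeft => CComp L R
  | CRight => CComp R R
  | COracle => o
  | CPair a b => CPair (subst_code o a) (subst_code o b)
  | CComp a b => CComp (subst_code o a) (CPair L (subst_code o b))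
  | CPrec a b =>
      CComp (CPrec (subst_code o a)
               (CComp (subst_code o b)
                  (CPair (CComp L L) (CPair (CComp R L) R))))
        (CPair (CPair L (CComp L R)) (CComp R R))
  | CMu a =>
      CMu (CComp (subst_code o a)
             (CPair (CComp L L) (CPair (CComp R L) R)))
  end.

Lemma eval_CLeft p a b : eval CLeft p (pr a b) a.
Proof. symmetry; apply pi1_pr. Qed.

Lemma eval_CRight p a b : eval CRight p (pr a b) b.
Proof. symmetry; apply pi2_pr. Qed.

Lemma eval_CPair a b p x u v :
  eval a p x u -> eval b p x v -> eval (CPair a b) p x (pr u v).
Proof. exists u, v; auto. Qed.

Lemma eval_CComp a b p x u y :
  eval b p x u -> eval a p u y -> eval (CComp a b) p x y.
Proof. exists u; auto. Qed.

Lemma eval_reassoc p z x y :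
  eval (CPair (CComp CLeft CLeft) (CPair (CComp CRight CLeft) CRight)) p
    (pr (pr z x) y) (pr z (pr x y)).
Proof.
  repeat eapply eval_CPair; repeat first
    [ eapply eval_CComp | apply eval_CLeft | apply eval_CRight ].
Qed.

Lemma eval_subst_code o p q z :
  (forall i, eval o p (pr z i) (q i)) ->
  forall c x y, eval c q x y -> eval (subst_code o c) p (pr z x) y.
Proof.
  intro Ho; induction c; intros x y H; cbn [subst_code].
  - exact H.
  - exists x; split; [apply eval_CRight | exact H].
  - exists x; split; [apply eval_CRight | exact H].
  - exists x; split; [apply eval_CRight | exact H].
  - cbn in H; rewrite H; apply Ho.
  - destruct H as (u & v & Hu & Hv & ->); apply eval_CPair; auto.
  - destruct H as (u & Hu & Hv).
    eapply eval_CComp; [eapply eval_CPair; [apply eval_CLeft | eauto] | eauto].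
  - apply eval_CComp with (u := pr (pr z (pi1 x)) (pi2 x)).
    { repeat eapply eval_CPair; try (apply eval_CLeft);
        (eapply eval_CComp; [apply eval_CRight | reflexivity]). }
    rewrite <- (pr_pi x) in H; generalize dependent y.
    induction (pi2 x) as [|m IH]; intros y H.
    + apply eval_prec_0; apply eval_prec_0 in H; auto.
    + apply eval_prec_S in H; destruct H as (u & Hu & H).
      apply eval_prec_S; exists u; split; [auto|].
      eapply eval_CComp; [apply eval_reassoc | auto].
  - destruct H as [H Hlt]; split.
    + eapply eval_CComp; [apply eval_reassoc | auto].
    + intros i Hi; destruct (Hlt i Hi) as [v Hv]; exists v.
      eapply eval_CComp; [apply eval_reassoc | auto].
Qed.

(* A staged function returns [0] as long as the value is unknown, and [S v]
   when it has found the value [v]. *)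
Definition monotone (r : baire -> nat -> nat -> nat) : Prop :=
  forall p x s t v, s <= t -> r p x s = S v -> r p x t = S v.

Definition staged (r : baire -> nat -> nat -> nat) : Prop :=
  recursive (fun p x => r p (pi1 x) (pi2 x)) /\ monotone r.

Lemma staged_total f : recursive f -> staged (fun p x _ => S (f p x)).
Proof.
  intro H; split.
  - recursive.
  - intros p x s t v _ E; exact E.
Qed.

(* State of the search for the least zero of a function known in stages: [0]
   while all values seen are positive, [1] after an unknown value, and
   [S (S y)] once the zero [y] has been found. *)
Definition mu_state (f : nat -> nat) : nat -> nat :=
  nat_rect (fun _ => nat) 0 (fun m st =>
    match st with
    | 0 => match f m with
           | 0 => 1
           | S w => match w with 0 => S (S m) | S _ => 0 end
           end
    | S _ => st
    end).

(** In staged form [1] is the known value zero and [S (S v)] the known positive value [S v]. *)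
Lemma mu_state_0 f n :
  mu_state f n = 0 <-> forall i, i < n -> exists v, f i = S (S v).
Proof.
  induction n as [|n IH]; cbn.
  - split; [intros _ i Hi; lia | reflexivity].
  - fold (mu_state f n); split.
    + destruct (mu_state f n) as [|st]; [|discriminate].
      intros E i Hi.
      destruct (Nat.eq_dec i n) as [->|Hn]; [|apply IH; [reflexivity|lia]].
      destruct (f n) as [|[|v]]; try discriminate; eauto.
    + intro H; rewrite (proj2 IH) by (intros; apply H; lia).
      now destruct (H n (Nat.lt_succ_diag_r n)) as [v ->].
Qed.

Lemma mu_state_SS f n y :
  mu_state f n = S (S y) <->
  y < n /\ f y = 1 /\ forall i, i < y -> exists v, f i = S (S v).
Proof.
  induction n as [|n IH]; cbn.
  - split; [discriminate | lia].
  - fold (mu_state f n).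
    assert (H0 := mu_state_0 f n).
    destruct (mu_state f n) as [|st].
    + split.
      * destruct (f n) as [|[|w]] eqn:E; try discriminate.
        intro Hy; injection Hy as <-; repeat split; [lia|assumption|].
        now apply H0.
      * intros (Hy & E & Hlt).
        destruct (Nat.eq_dec y n) as [->|Hn]; [now rewrite E|].
        destruct (proj1 H0 eq_refl y) as [v Hv]; [lia|congruence].
    + rewrite IH; split; [intuition lia|].
      intros (Hy & E & Hlt); repeat split; try assumption.
      destruct (Nat.eq_dec y n) as [->|Hn]; [|lia].
      now apply H0 in Hlt.
Qed.

(** Only halting computations are constrained. For them monotonicity makes the value found
    independent of the stage, and finitely many stages can be replaced by their maximum. *)
Lemma code_staged c :
  exists r, staged r /\
    forall p x y, eval c p x y -> exists s, r p x s = S y.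
Proof.
  induction c.
  - exists (fun p x _ => S 0); split; [|intros p x y ->; now exists 0].
    apply (staged_total (recursive_const 0)).
  - exists (fun p x _ => S (S x)); split; [|intros p x y ->; now exists 0].
    apply (staged_total (f := fun _ x => S x)); recursive.
  - exists (fun p x _ => S (pi1 x)); split; [|intros p x y ->; now exists 0].
    apply (staged_total (f := fun _ x => pi1 x)); recursive.
  - exists (fun p x _ => S (pi2 x)); split; [|intros p x y ->; now exists 0].
    apply (staged_total (f := fun _ x => pi2 x)); recursive.
  - exists (fun p x _ => S (p x)); split; [|intros p x y ->; now exists 0].
    apply (staged_total (f := fun p x => p x)); recursive.
  - destruct IHc1 as (r1 & [H1 M1] & C1), IHc2 as (r2 & [H2 M2] & C2).
    exists (fun p x s => match r1 p x s with 0 => 0 | S u =>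
              match r2 p x s with 0 => 0 | S v => S (pr u v) end end).
    split; [split|].
    + recursive.
    + intros p x s t v Hst; cbn beta.
      destruct (r1 p x s) as [|u] eqn:E1; [discriminate|].
      destruct (r2 p x s) as [|w] eqn:E2; [discriminate|].
      now rewrite (M1 _ _ _ _ _ Hst E1), (M2 _ _ _ _ _ Hst E2).
    + intros p x y (u & v & Hu & Hv & ->).
      destruct (C1 _ _ _ Hu) as [s Hs], (C2 _ _ _ Hv) as [t Ht].
      exists (max s t).
      now rewrite (M1 _ _ _ _ _ (Nat.le_max_l s t) Hs),
        (M2 _ _ _ _ _ (Nat.le_max_r s t) Ht).
  - destruct IHc1 as (r1 & [H1 M1] & C1), IHc2 as (r2 & [H2 M2] & C2).
    exists (fun p x s => match r2 p x s with 0 => 0 | S u => r1 p u s end).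
    split; [split|].
    + recursive.
    + intros p x s t v Hst; cbn beta.
      destruct (r2 p x s) as [|w] eqn:E2; [discriminate|].
      rewrite (M2 _ _ _ _ _ Hst E2); eauto.
    + intros p x y (u & Hu & Hv).
      destruct (C2 _ _ _ Hu) as [s Hs], (C1 _ _ _ Hv) as [t Ht].
      exists (max s t).
      rewrite (M2 _ _ _ _ _ (Nat.le_max_l s t) Hs); eauto using Nat.le_max_r.
  - destruct IHc1 as (r1 & [H1 M1] & C1), IHc2 as (r2 & [H2 M2] & C2).
    set (r := fun p x s => nat_rect (fun _ => nat) (r1 p (pi1 x) s)
      (fun m acc => match acc with
                    | 0 => 0
                    | S u => r2 p (pr (pi1 x) (pr m u)) s
                    end) (pi2 x)).
    assert (M : monotone r).
    { intros p x s t v Hst; unfold r; revert v.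
      induction (pi2 x) as [|m IH]; intro v; cbn [nat_rect]; [eauto|].
      match goal with |- match ?acc with _ => _ end = _ -> _ =>
        destruct acc as [|u] end; [discriminate|].
      rewrite (IH u eq_refl); eauto. }
    exists r; split; [split; [unfold r; recursive | exact M]|].
    intros p x y H; rewrite <- (pr_pi x) in H |- *.
    revert y H; induction (pi2 x) as [|m IH]; intros y H.
    + apply eval_prec_0 in H; destruct (C1 _ _ _ H) as [s Hs]; exists s.
      unfold r; now rewrite pi1_pr, pi2_pr.
    + apply eval_prec_S in H; destruct H as (u & Hu & H).
      destruct (IH _ Hu) as [s Hs], (C2 _ _ _ H) as [t Ht].
      apply (M _ _ _ _ _ (Nat.le_max_l s t)) in Hs.
      apply (M2 _ _ _ _ _ (Nat.le_max_r s t)) in Ht.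
      exists (max s t); revert Hs Ht; unfold r; rewrite !pi1_pr, !pi2_pr.
      cbn [nat_rect]; intros ->; auto.
  - destruct IHc as (r & [H M] & C).
    (* The stage [s] bounds both the candidates searched and the effort spent on each of them.
       [pred] turns the running and the blocked state into the unknown value [0], and [S (S y)] into
       the staged value [S y]. *)
    exists (fun p x s =>
      pred (mu_state (fun y => r p (pr x y) s) s)).
    split; [split|].
    + unfold mu_state, pred; recursive.
    + intros p x s t v Hst E.
      assert (E' : mu_state (fun y => r p (pr x y) s) s = S (S v))
        by (destruct (mu_state _ s); [discriminate | cbn in E; congruence]).
      apply mu_state_SS in E'; destruct E' as (Hv & E1 & Hlt).
      enough (E' : mu_state (fun y => r p (pr x y) t) t = S (S v))
        by now rewrite E'.
      apply mu_state_SS; repeat split; [lia | eauto |].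
      intros i Hi; destruct (Hlt i Hi) as [w Hw]; eauto.
    + intros p x y [H0 Hlt].
      assert (Hs : exists s, forall i, i < y -> exists v, r p (pr x i) s = S (S v)).
      { clear H0; induction y as [|y IH]; [exists 0; lia|].
        destruct IH as [s Hs]; [intros; apply Hlt; lia|].
        destruct (Hlt y) as [v Hv]; [lia|].
        destruct (C _ _ _ Hv) as [t Ht].
        exists (max s t); intros i Hi.
        destruct (Nat.eq_dec i y) as [->|Hn].
        - exists v; eauto using Nat.le_max_r.
        - destruct (Hs i) as [w Hw]; [lia|].
          exists w; eauto using Nat.le_max_l. }
      destruct Hs as [s Hs], (C _ _ _ H0) as [t Ht].
      (* The successor is there because [mu_state] inspects only candidates strictly below its
         bound, and [y] must be among them. *)
      exists (S (max y (max s t))); cbn beta.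
      enough (E : mu_state (fun i => r p (pr x i) (S (max y (max s t))))
        (S (max y (max s t))) = S (S y)) by now rewrite E.
      apply mu_state_SS; repeat split; [lia | apply M with t; [lia|assumption] |].
      intros i Hi; destruct (Hs i Hi) as [v Hv]; exists v.
      apply M with s; [lia|assumption].
Qed.

(** The search stops at the least zero [t], which may lie below the given zero [s]. *)
Lemma recursive_mu g :
  recursive (fun p x => g p (pi1 x) (pi2 x)) ->
  exists c, forall p x s, g p x s = 0 ->
    exists t, g p x t = 0 /\ eval c p x t.
Proof.
  intros [c Hc]; exists (CMu c); intros p x s Hs.
  assert (Hc' : forall y, eval c p (pr x y) (g p x y)).
  { intro y; specialize (Hc p (pr x y)); now rewrite pi1_pr, pi2_pr in Hc. }
  induction s as [s IH] using lt_wf_ind.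
  destruct (classic (exists i, i < s /\ g p x i = 0)) as [(i & Hi & E)|Hn].
  - exact (IH i Hi E).
  - exists s; split; [assumption|split].
    + rewrite <- Hs; apply Hc'.
    + intros i Hi; specialize (Hc' i); destruct (g p x i) as [|v] eqn:E; eauto.
      exfalso; eauto.
Qed.

(** Search for the first stage at which the value is known and read the value off; by monotonicity
    it agrees with the one known at stage [s]. *)
Lemma staged_code r :
  staged r -> exists c, forall p x s y, r p x s = S y -> eval c p x y.
Proof.
  intros [H M].
  destruct (@recursive_mu (fun p x s => match r p x s with 0 => 1 | S _ => 0 end))
    as [c Hc]; [recursive|].
  assert (Hd : recursive (fun p x => pred (r p (pi1 x) (pi2 x))))
    by (unfold pred; recursive).
  destruct Hd as [d Hd].
  exists (CComp d (CPair (CPair CLeft CRight) c)); intros p x s y E.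
  destruct (Hc p x s) as (t & Ht & Et); [now rewrite E|].
  exists (pr x t); split.
  - apply eval_CPair; [|exact Et].
    exists (pi1 x), (pi2 x); repeat split; symmetry; apply pr_pi.
  - specialize (Hd p (pr x t)); rewrite pi1_pr, pi2_pr in Hd.
    destruct (r p x t) as [|v] eqn:E'; [discriminate|].
    destruct (Nat.le_ge_cases s t) as [L|L].
    + rewrite (M _ _ _ _ _ L E) in E'; now injection E' as ->.
    + rewrite (M _ _ _ _ _ L E') in E; now injection E as ->.
Qed.

(* [C] has a computable extension; its single-valuedness is a consequence, not
   a proof obligation. *)
Definition crel (C : baire -> baire -> Prop) : Prop :=
  exists c, forall p q, C p q -> forall n, eval c p n (q n).

Definition code_fun (c : code) : pfun baire baire :=
  @PFun baire baire (fun p q => forall n, eval c p n (q n))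
    (fun p q q' H H' => functional_extensionality q q'
      (fun n => eval_fun (H n) (H' n))).

Lemma code_fun_computable c : computable (code_fun c).
Proof. now exists c. Qed.

Lemma crel_weaken (C D : baire -> baire -> Prop) :
  (forall p q, D p q -> C p q) -> crel C -> crel D.
Proof. intros H [c Hc]; exists c; auto. Qed.

Lemma crel_recursive f : recursive f -> crel (fun p q => q = f p).
Proof. intros [c Hc]; exists c; intros p q -> n; apply Hc. Qed.

Lemma crel_comp C D :
  crel C -> crel D -> crel (fun p q => exists u, C p u /\ D u q).
Proof.
  intros [c Hc] [d Hd].
  (* The oracle [u] depends on no parameter, so [0] is passed and [CRight] drops it. *)
  exists (CComp (subst_code (CComp c CRight) d) (CPair CZero (CPair CLeft CRight))).
  intros p q (u & Hu & Hq) n; exists (pr 0 n); split.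
  - apply eval_CPair; [reflexivity|].
    exists (pi1 n), (pi2 n); repeat split; symmetry; apply pr_pi.
  - apply eval_subst_code with (q := u); [|auto].
    intro i; exists i; split; [apply eval_CRight | auto].
Qed.

(** * Arithmetic of pairs and sequences of names *)

(** [Nat.even] and [Nat.div2] descend by two, and the former is Boolean; this version and [half]
    descend by one and are primitive recursive as written. *)
Fixpoint parity (n : nat) : nat :=
  match n with 0 => 0 | S m => match parity m with 0 => 1 | S _ => 0 end end.

Fixpoint half (n : nat) : nat :=
  match n with
  | 0 => 0
  | S m => match parity m with 0 => half m | S _ => S (half m) end
  end.

Lemma parity_half k :
  (parity (2 * k) = 0 /\ half (2 * k) = k) /\
  (parity (2 * k + 1) = 1 /\ half (2 * k + 1) = k).
Proof.
  induction k as [|k [_ [IH1 IH2]]]; [now cbn|].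
  assert (E : parity (2 * S k) = 0 /\ half (2 * S k) = S k).
  { replace (2 * S k) with (S (2 * k + 1)) by lia; cbn [parity half].
    now rewrite IH1, IH2. }
  split; [exact E|].
  rewrite Nat.add_1_r; cbn [parity half]; now rewrite (proj1 E), (proj2 E).
Qed.

Lemma bpairE p q n :
  bpair p q n = match parity n with 0 => p (half n) | S _ => q (half n) end.
Proof.
  unfold bpair.
  destruct (Nat.Even_or_Odd n) as [[k ->]|[k ->]];
    destruct (parity_half k) as [[E1 E2] [E3 E4]].
  - rewrite E1, E2, Nat.div2_double, Nat.even_even; reflexivity.
  - rewrite E3, E4, Nat.even_odd, Nat.add_1_r, Nat.div2_succ_double; reflexivity.
Qed.

Lemma recursive_ext f g : (forall p n, f p n = g p n) -> recursive f -> recursive g.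
Proof. intros E [c Hc]; exists c; intros p n; rewrite <- E; apply Hc. Qed.

Lemma recursive_parity g : recursive g -> recursive (fun p n => parity (g p n)).
Proof.
  intro H; refine (recursive_comp (f := fun _ n => parity n) _ H).
  apply recursive_ext with (fun _ n => nat_rect (fun _ => nat) 0
    (fun m u => match u with 0 => 1 | S _ => 0 end) n).
  - intros _ n; induction n as [|n IH]; cbn in *; [reflexivity | now rewrite IH].
  - recursive.
Qed.

Lemma recursive_half g : recursive g -> recursive (fun p n => half (g p n)).
Proof.
  intro H; refine (recursive_comp (f := fun _ n => half n) _ H).
  apply recursive_ext with (fun _ n => nat_rect (fun _ => nat) 0
    (fun m u => match parity m with 0 => u | S _ => S u end) n).
  - intros _ n; induction n as [|n IH]; cbn in *; [reflexivity | now rewrite IH].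
  - recursive; apply recursive_parity; recursive.
Qed.

Lemma recursive_add f g :
  recursive f -> recursive g -> recursive (fun p n => f p n + g p n).
Proof.
  intros Hf Hg.
  apply recursive_ext with (fun p n => nat_rect (fun _ => nat) (g p n)
    (fun m u => S u) (f p n)).
  - intros p n; induction (f p n); cbn in *; congruence.
  - recursive.
Qed.

Lemma recursive_sub f g :
  recursive f -> recursive g -> recursive (fun p n => f p n - g p n).
Proof.
  intros Hf Hg.
  apply recursive_ext with (fun p n => nat_rect (fun _ => nat) (f p n)
    (fun m u => match u with 0 => 0 | S v => v end) (g p n)).
  - intros p n; induction (g p n) as [|k IH]; cbn [nat_rect]; [lia|].
    rewrite IH; destruct (f p n - k) eqn:E; lia.
  - recursive.
Qed.

Lemma recursive_bpair f g h :
  recursive (fun p n => f p n) -> recursive (fun p n => g p n) -> recursive h ->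
  recursive (fun p n => bpair (f p) (g p) (h p n)).
Proof.
  intros Hf Hg Hh.
  apply recursive_ext with (fun p n =>
    match parity (h p n) with
    | 0 => f p (half (h p n))
    | S _ => g p (half (h p n))
    end).
  - intros p n; symmetry; apply bpairE.
  - recursive; first [apply recursive_parity | apply recursive_half]; recursive.
Qed.

(** Here the oracle itself is transformed, which [recursive_comp] does not cover; the program comes
    from composing the two graphs. *)
Lemma recursive_subst f g h :
  recursive f -> recursive (fun p n => g p n) -> recursive h ->
  recursive (fun p n => f (g p) (h p n)).
Proof.
  intros Hf Hg Hh.
  refine (recursive_comp (f := fun p => f (g p)) _ Hh).
  destruct (crel_comp (crel_recursive Hg) (crel_recursive Hf)) as [c Hc].
  exists c; intro p; apply Hc; now exists (fun n => g p n).
Qed.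

(** Row [i] of a double sequence whose entry in row [i] and column [j] is stored at index
    [pr i j]. *)
Definition section (i : nat) (r : baire) : baire :=
  fun m => r (pr (pr i (pi1 m)) (pi2 m)).

Lemma bproj_section i j r : bproj j (section i r) = bproj (pr i j) r.
Proof.
  apply functional_extensionality; intro n; unfold bproj, section.
  fold (pr j n) (pr i j); now rewrite pi1_pr, pi2_pr.
Qed.

Ltac recursive_op :=
  match goal with |- recursive ?f => change (recursive (fun p n => f p n)) end;
  change bproj with (fun i (p : baire) k => p (pr i k));
  (* [2 * n] is exposed as the sum it reduces to, which [recursive_add] handles. *)
  change bfst with (fun (p : baire) n => p (n + (n + 0)));
  change bsnd with (fun (p : baire) n => p (n + (n + 0) + 1));
  unfold section, btail, bcons;
  cbn beta;
  repeat first
    [ recursive_step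
    | match goal with
      | |- recursive (fun p n => @?f p n + @?g p n) => apply (@recursive_add f g)
      | |- recursive (fun p n => @?f p n - @?g p n) => apply (@recursive_sub f g)
      | |- recursive (fun p n => parity (@?g p n)) => apply (@recursive_parity g)
      | |- recursive (fun p n => half (@?g p n)) => apply (@recursive_half g)
      | |- recursive (fun p n => bpair (@?f p) (@?g p) (@?h p n)) =>
          apply (@recursive_bpair f g h); cbn beta
      | H : recursive ?f |- recursive (fun p n => ?f (@?g p) (@?h p n)) =>
          apply (@recursive_subst f g h); [exact H | cbn beta |]
      end ].

(** * Reading and writing words with dummy symbols *)

Lemma minus1_word_S p n :
  minus1_word p (S n) =
  minus1_word p n ++ match p n with 0 => nil | S a => a :: nil end.
Proof.
  unfold minus1_word; rewrite seq_S, flat_map_app; cbn.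
  now rewrite app_nil_r.
Qed.

Definition symbol_count (p : baire) : nat -> nat :=
  nat_rect (fun _ => nat) 0 (fun m u => match p m with 0 => u | S _ => S u end).

Lemma symbol_countE p n : symbol_count p n = length (minus1_word p n).
Proof.
  induction n as [|n IH]; [reflexivity|].
  rewrite minus1_word_S, length_app; cbn; fold (symbol_count p n).
  rewrite IH; destruct (p n); cbn; lia.
Qed.

(** A staged search for symbol [k] of the word. The sum of the two truncated differences vanishes
    exactly when [k] symbols precede position [m]. *)
Definition symbol (p : baire) (k : nat) : nat -> nat :=
  nat_rect (fun _ => nat) 0 (fun m acc =>
    match acc with
    | 0 => match p m with
           | 0 => 0
           | S a => match (symbol_count p m - k) + (k - symbol_count p m) with
                    | 0 => S a
                    | S _ => 0
                    end
           end
    | S _ => acc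
    end).

Lemma symbolE p k n :
  symbol p k n = match nth_error (minus1_word p n) k with
                 | Some a => S a
                 | None => 0
                 end.
Proof.
  induction n as [|n IH]; [now destruct k|].
  rewrite minus1_word_S; cbn; fold (symbol p k n); rewrite IH, symbol_countE.
  destruct (nth_error (minus1_word p n) k) as [a|] eqn:E.
  - rewrite nth_error_app1, E; [reflexivity|].
    apply nth_error_Some; congruence.
  - apply nth_error_None in E; rewrite nth_error_app2 by assumption.
    destruct (p n) as [|a]; [now destruct (k - _)|].
    replace (length (minus1_word p n) - k) with 0 by lia; cbn.
    destruct (k - length (minus1_word p n)) as [|m]; [reflexivity|now destruct m].
Qed.

(** In staged form partial computations become total functions, so they can be merged by arithmetic
    case distinctions. *)
Lemma crel_staged C :
  crel C <->
  exists r, staged r /\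
    forall p q, C p q -> forall n, exists s, r p n s = S (q n).
Proof.
  split.
  - intros [c Hc]; destruct (code_staged c) as (r & Hr & H).
    exists r; split; [assumption|]; eauto.
  - intros (r & Hr & H); destruct (staged_code Hr) as [c Hc].
    exists c; intros p q Hpq n; destruct (H p q Hpq n); eauto.
Qed.

Lemma crel_minus1 : crel minus1.
Proof.
  apply crel_staged; exists symbol; split; [split|].
  - unfold symbol, symbol_count; recursive_op.
  - intros p k s t v Hst; rewrite !symbolE.
    destruct (nth_error (minus1_word p s) k) as [a|] eqn:E; [|discriminate].
    now rewrite (minus1_word_mono Hst E).
  - intros p q H k; destruct (H k) as [n Hn]; exists n.
    now rewrite symbolE, Hn.
Qed.

Lemma crel_pair C D :
  crel C -> crel D ->
  crel (fun p q => exists u v, C p u /\ D p v /\ q = bpair u v).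
Proof.
  rewrite !crel_staged; intros (r & [Hr M] & HC) (r' & [Hr' M'] & HD).
  exists (fun p x s => match parity x with
                       | 0 => r p (half x) s
                       | S _ => r' p (half x) s
                       end).
  split; [split|].
  - recursive_op.
  - intros p x s t v Hst; destruct (parity x); eauto.
  - intros p q (u & v & Hu & Hv & ->) n; rewrite bpairE.
    destruct (parity n); eauto.
Qed.

Lemma crel_if t C D :
  recursive (fun p _ => t p) -> crel C -> crel D ->
  crel (fun p q => match t p with 0 => C p q | S _ => D p q end).
Proof.
  rewrite !crel_staged; intros Ht (r & [Hr M] & HC) (r' & [Hr' M'] & HD).
  exists (fun p x s => match t p with 0 => r p x s | S _ => r' p x s end).
  split; [split|].
  - recursive_op.
  - intros p x s u v Hsu; destruct (t p); eauto.
  - intros p q H n; destruct (t p); eauto.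
Qed.

(** The number of positions copied so far when [f k] yields the value at position [k] in stages: at
    step [m] the current position advances only if its value is known at stage [m]. *)
Definition pointer (f : nat -> nat -> nat) : nat -> nat :=
  nat_rect (fun _ => nat) 0
    (fun m k => match f k m with 0 => k | S _ => S k end).

(** Known values of [q], including its own dummy symbols, are copied verbatim, and waiting inserts
    only further zeros. So the word emitted in [n] steps is that of the first [pointer f n] values
    of [q], and the pointer is unbounded because every value becomes known. *)
Lemma pointer_emits (f : nat -> nat -> nat) (q : baire) :
  (forall k s t v, s <= t -> f k s = S v -> f k t = S v) ->
  (forall k, exists s, f k s = S (q k)) ->
  forall q', minus1 q q' -> minus1 (fun n => pred (f (pointer f n) n)) q'.
Proof.
  intros M H q' Hq'.
  assert (Hw : forall n, minus1_word (fun n => pred (f (pointer f n) n)) n =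
                         minus1_word q (pointer f n)).
  { induction n as [|n IH]; [reflexivity|].
    rewrite minus1_word_S, IH; cbn [pointer nat_rect]; fold (pointer f n).
    destruct (f (pointer f n) n) as [|v] eqn:E; [apply app_nil_r|].
    rewrite minus1_word_S; destruct (H (pointer f n)) as [s Hs].
    apply (M _ _ _ _ (Nat.le_max_l s n)) in Hs.
    apply (M _ _ _ _ (Nat.le_max_r s n)) in E.
    replace v with (q (pointer f n)) by congruence; reflexivity. }
  assert (mono : forall m n, m <= n -> pointer f m <= pointer f n).
  { intros m n Hmn; induction Hmn as [|n _ IH]; [reflexivity|].
    cbn [pointer nat_rect]; fold (pointer f n).
    destruct (f (pointer f n) n); lia. }
  assert (unbounded : forall k, exists n, k <= pointer f n).
  { induction k as [|k [n Hn]]; [exists 0; lia|].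
    destruct (H k) as [s Hs]; exists (S (max n s)).
    assert (L := mono _ _ (Nat.le_max_l n s)).
    cbn [pointer nat_rect]; fold (pointer f (max n s)).
    destruct (Nat.eq_dec (pointer f (max n s)) k) as [->|Hk].
    - now rewrite (M _ _ _ _ (Nat.le_max_r n s) Hs).
    - clear Hs; destruct (f _ _); lia. }
  intro k; destruct (Hq' k) as [m Hm], (unbounded m) as [n Hn].
  exists n; rewrite Hw; eapply minus1_word_mono; eauto.
Qed.

(* A partial computable function, applied in parallel to all [bcons i p], has
   a total computable counterpart on completions: until the next symbol of the
   result is known, it outputs the dummy symbol [0]. *)
Lemma crel_lift C :
  crel C ->
  exists L, recursive L /\
    forall i p q q', C (bcons i p) q -> minus1 q q' -> minus1 (bproj i (L p)) q'.
Proof.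
  intros [c Hc].
  (* The parameter of the substitution is the index [i]: the oracle [bcons i p] is computed from [p]
     and [i]. *)
  assert (Ho : recursive (fun p x => bcons (pi1 x) p (pi2 x))) by recursive_op.
  destruct Ho as [o Ho], (code_staged (subst_code o c)) as (r & [Hr M] & H).
  exists (fun p x => pred (r p (pr (pi1 x)
    (pointer (fun k => r p (pr (pi1 x) k)) (pi2 x))) (pi2 x))); split.
  - unfold pointer, pred; recursive_op.
  - intros i p q q' HC Hq.
    replace (bproj i _) with
      (fun n => pred (r p (pr i (pointer (fun k => r p (pr i k)) n)) n)).
    + apply pointer_emits with (f := fun k => r p (pr i k)) (q := q); eauto.
      intro k; apply H.
      apply eval_subst_code with (q := bcons i p); [|auto].
      intro j; specialize (Ho p (pr i j)); now rewrite pi1_pr, pi2_pr in Ho.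
    + apply functional_extensionality; intro n; unfold bproj; fold (pr i n).
      now rewrite pi1_pr, pi2_pr.
Qed.

(** Keeps the input [u] beside the intermediate result [v], which [crel_comp] would forget. It lets
    the tactic [crel] read a computation off an existential formula. *)
Lemma crel_bind f C (E : baire -> baire -> baire -> Prop) :
  recursive f -> crel C -> crel (fun w q => E (bfst w) (bsnd w) q) ->
  crel (fun u q => exists v, C (f u) v /\ E u v q).
Proof.
  intros Hf HC HE.
  apply crel_weaken with (2 := crel_comp
    (crel_pair (crel_recursive (f := fun u => u) (recursive_oracle recursive_id))
       (crel_comp (crel_recursive Hf) HC)) HE).
  intros u q (v & Hv & Hq); exists (bpair u v); split.
  - exists u, v; eauto.
  - now rewrite bfst_bpair, bsnd_bpair.
Qed.

Lemma crel_precomp f C :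
  recursive f -> crel C -> crel (fun u q => C (f u) q).
Proof.
  intros Hf HC; apply crel_weaken with (2 := crel_comp (crel_recursive Hf) HC).
  eauto.
Qed.

Ltac crel :=
  repeat first
    [ assumption
    | exact crel_minus1
    | match goal with
      | |- crel (fun u q => exists v, ?C (@?f u) v /\ @?E u v q) =>
          apply (@crel_bind f C E); cbn beta
      | |- crel (fun u q => q = @?f u) =>
          apply (@crel_recursive f); recursive_op
      | |- crel (fun u q => ?C (@?f u) q) =>
          apply (@crel_precomp f C)
      | |- recursive _ => progress recursive_op
      end ].

(** * Weihrauch reducibility on names *)

(** The realizer of [Q] is replaced by an arbitrary answer at the one instance that is asked;
    [weihrauch_wr] justifies this. *)
Definition wr (R Q : baire -> baire -> Prop) : Prop :=
  exists H K, crel H /\ crel K /\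
  forall p, mdom R p -> exists k, K p k /\ mdom Q k /\
    forall r, Q k r -> exists q, H (bpair p r) q /\ R p q.

Lemma wr_total_intro R Q K H :
  recursive K -> crel H ->
  (forall p, mdom R p -> mdom Q (K p) /\
    forall r, Q (K p) r -> exists q, H (bpair p r) q /\ R p q) ->
  wr R Q.
Proof.
  intros HK HH spec; exists H, (fun p k => k = K p).
  repeat split; [assumption | now apply crel_recursive |].
  intros p Hp; destruct (spec p Hp); eauto.
Qed.

Lemma wr_refl R : wr R R.
Proof.
  apply wr_total_intro with (K := fun p => p) (H := fun u q => q = bsnd u).
  - recursive_op.
  - crel.
  - intros p Hp; split; [assumption|]; intros r Hr; exists r.
    now rewrite bsnd_bpair.
Qed.

Lemma wr_trans R Q T : wr R Q -> wr Q T -> wr R T.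
Proof.
  intros (H1 & K1 & HH1 & HK1 & spec1) (H2 & K2 & HH2 & HK2 & spec2).
  exists (fun u q => exists k, K1 (bfst u) k /\ exists r,
      H2 (bpair k (bsnd u)) r /\ H1 (bpair (bfst u) r) q),
    (fun p k => exists v, K1 p v /\ K2 v k).
  split; [crel|split; [crel|]].
  intros p Hp; destruct (spec1 p Hp) as (v & Hv & Dv & R1).
  destruct (spec2 v Dv) as (k & Hk & Dk & R2).
  exists k; split; [eauto|split; [assumption|]]; intros r Hr.
  destruct (R2 r Hr) as (r' & Hr' & Sr'), (R1 r' Sr') as (q & Hq & Rq).
  exists q; split; [|assumption].
  exists v; rewrite bfst_bpair, bsnd_bpair; eauto.
Qed.

(** * Completed parallelization as a closure operator *)

Definition compl (R : baire -> baire -> Prop) (p q : baire) : Prop :=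
  forall p', minus1 p p' -> mdom R p' -> exists q', minus1 q q' /\ R p' q'.

Definition par (R : baire -> baire -> Prop) (p q : baire) : Prop :=
  forall i, R (bproj i p) (bproj i q).

Definition hb (R : baire -> baire -> Prop) := par (compl R).

Lemma choice_fun (A B : Type) (P : A -> B -> Prop) :
  (forall a, exists b, P a b) -> exists f, forall a, P a (f a).
Proof.
  intro H.
  exists (fun a => proj1_sig (constructive_indefinite_description _ (H a))).
  intro a; apply proj2_sig.
Qed.

Lemma compl_total R p : mdom (compl R) p.
Proof.
  destruct (classic (exists p', minus1 p p' /\ mdom R p'))
    as [(p' & Hp & q & Hq)|Hn].
  - exists (fun n => S (q n)); intros p'' Hp'' _; exists q.
    split; [apply minus1_succ | now rewrite (minus1_fun Hp'' Hp)].
  - exists p; intros p' Hp Hd; exfalso; eauto.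
Qed.

Lemma hb_total R p : mdom (hb R) p.
Proof.
  destruct (choice_fun (fun i => compl_total R (bproj i p))) as [q Hq].
  exists (bseq q); intro i; rewrite bproj_bseq; apply Hq.
Qed.

(** Meant for instances [p'] built by [crel_lift], of which nothing is known where the intended
    instance [p] has no infinite word: their answers still serve for [p]. *)
Lemma compl_weaken R p p' q :
  (forall x, minus1 p x -> minus1 p' x) -> compl R p' q -> compl R p q.
Proof. intros E H x Hx; apply H; auto. Qed.

Lemma compl_apply R p p' q :
  compl R p q -> minus1 p p' -> mdom R p' -> exists q', minus1 q q' /\ R p' q'.
Proof. intro H; exact (H p'). Qed.

Lemma wr_hb_r R : wr R (hb R).
Proof.
  (* The instance is the constant sequence of [p], shifted by one so that it contains no dummy
     symbols; the answer is read from entry [0]. *)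
  apply wr_total_intro with (K := fun p n => S (p (pi2 n)))
    (H := fun u q => minus1 (bproj 0 (bsnd u)) q).
  - recursive_op.
  - crel.
  - intros p Hp; split; [apply hb_total|]; intros r Hr.
    rewrite bsnd_bpair; apply (Hr 0 p); [|assumption].
    replace (bproj 0 _) with (fun n => S (p n)); [apply minus1_succ|].
    apply functional_extensionality; intro n; unfold bproj.
    fold (pr 0 n); now rewrite pi2_pr.
Qed.

(** Query [j] raised by instance [i] goes to index [pr i j], and row [i] of the answers is decoded
    to answer instance [i]. Whether an instance is proper never has to be decided, since [LK] and
    [LH] are total. *)
Lemma wr_hb R Q : wr R (hb Q) -> wr (hb R) (hb Q).
Proof.
  intros (H & K & HH & HK & spec).
  destruct (@crel_lift (fun u q => exists p',
      minus1 (bproj (pi1 (u 0)) (btail u)) p' /\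
      exists k, K p' k /\ q = bproj (pi2 (u 0)) k))
    as (LK & LK_rec & LK_spec); [crel|].
  destruct (@crel_lift (fun u q => exists p',
      minus1 (bproj (u 0) (bfst (btail u))) p' /\
      exists t, H (bpair p' (section (u 0) (bsnd (btail u)))) t /\
      q = fun n => S (t n)))
    as (LH & LH_rec & LH_spec); [crel|].
  apply wr_total_intro with (K := LK) (H := fun u q => q = LH u);
    [assumption | crel |].
  intros p _; split; [apply hb_total|]; intros r Hr.
  exists (LH (bpair p r)); split; [reflexivity|]; intros i p' Hp' Dp'.
  destruct (spec p' Dp') as (k & Hk & _ & Rk).
  destruct (Rk (section i r)) as (t & Ht & Rt).
  { intro j; rewrite bproj_section.
    apply compl_weaken with (2 := Hr (pr i j)).
    intros x Hx; apply LK_spec with (q := bproj j k); [|assumption].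
    exists p'; cbn [bcons]; rewrite pi1_pr, pi2_pr; split; [exact Hp'|].
    exists k; auto. }
  exists t; split; [|assumption].
  apply LH_spec with (q := fun n => S (t n)); [|apply minus1_succ].
  exists p'; change (btail (bcons i (bpair p r))) with (bpair p r).
  rewrite bfst_bpair, bsnd_bpair; eauto.
Qed.

Lemma wr_hb_trans R Q T : wr R (hb Q) -> wr Q (hb T) -> wr R (hb T).
Proof. intros H1 H2; exact (wr_trans H1 (wr_hb H2)). Qed.

(** * Lattice operations on names *)

Definition sumR (R Q : baire -> baire -> Prop) (p q : baire) : Prop :=
  (p 0 = 0 /\ q 0 = 0 /\ R (btail p) (btail q)) \/
  (p 0 = 1 /\ q 0 = 1 /\ Q (btail p) (btail q)).

Definition infR (R Q : baire -> baire -> Prop) (p q : baire) : Prop :=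
  mdom R (bfst p) /\ mdom Q (bsnd p) /\
  ((q 0 = 0 /\ R (bfst p) (btail q)) \/ (q 0 = 1 /\ Q (bsnd p) (btail q))).

Definition prodR (R Q : baire -> baire -> Prop) (p q : baire) : Prop :=
  R (bfst p) (bfst q) /\ Q (bsnd p) (bsnd q).

Lemma prodR_hb_total R Q p : mdom (prodR (hb R) (hb Q)) p.
Proof.
  destruct (hb_total R (bfst p)) as [q Hq], (hb_total Q (bsnd p)) as [r Hr].
  exists (bpair q r); split; now rewrite ?bfst_bpair, ?bsnd_bpair.
Qed.

Lemma wr_sum_l R Q : wr R (sumR R Q).
Proof.
  apply wr_total_intro with (K := bcons 0) (H := fun u q => q = btail (bsnd u)).
  - recursive_op.
  - crel.
  - intros p [q Hq]; split; [exists (bcons 0 q); now left|].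
    intros r [(_ & _ & Hr)|(E & _)]; [|discriminate].
    exists (btail r); now rewrite bsnd_bpair.
Qed.

Lemma wr_sum_r R Q : wr Q (sumR R Q).
Proof.
  apply wr_total_intro with (K := bcons 1) (H := fun u q => q = btail (bsnd u)).
  - recursive_op.
  - crel.
  - intros p [q Hq]; split; [exists (bcons 1 q); now right|].
    intros r [(E & _)|(_ & _ & Hr)]; [discriminate|].
    exists (btail r); now rewrite bsnd_bpair.
Qed.

Lemma wr_sum_lub R Q T : wr R T -> wr Q T -> wr (sumR R Q) T.
Proof.
  intros (H1 & K1 & HH1 & HK1 & spec1) (H2 & K2 & HH2 & HK2 & spec2).
  exists (fun u q => match bfst u 0 with
      | 0 => exists v, H1 (bpair (btail (bfst u)) (bsnd u)) v /\ q = bcons 0 v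
      | S _ => exists v, H2 (bpair (btail (bfst u)) (bsnd u)) v /\ q = bcons 1 v
      end),
    (fun p k => match p 0 with 0 => K1 (btail p) k | S _ => K2 (btail p) k end).
  split; [apply (@crel_if (fun u => bfst u 0)); crel|].
  split; [apply (@crel_if (fun p => p 0)); crel|].
  intros p [q [(E & _ & Hq)|(E & _ & Hq)]].
  - destruct (spec1 (btail p)) as (k & Hk & Dk & Rk); [now exists (btail q)|].
    exists k; rewrite E; split; [assumption|split; [assumption|]]; intros r Hr.
    destruct (Rk r Hr) as (v & Hv & Rv); exists (bcons 0 v).
    rewrite bfst_bpair, bsnd_bpair, E; split; [eauto | left; auto].
  - destruct (spec2 (btail p)) as (k & Hk & Dk & Rk); [now exists (btail q)|].
    exists k; rewrite E; split; [assumption|split; [assumption|]]; intros r Hr.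
    destruct (Rk r Hr) as (v & Hv & Rv); exists (bcons 1 v).
    rewrite bfst_bpair, bsnd_bpair, E; split; [eauto | right; auto].
Qed.

Lemma wr_inf_l R Q : wr (infR R Q) R.
Proof.
  apply wr_total_intro with (K := bfst) (H := fun u q => q = bcons 0 (bsnd u)).
  - recursive_op.
  - crel.
  - intros p (q & D1 & D2 & _); split; [assumption|].
    intros r Hr; exists (bcons 0 r); rewrite bsnd_bpair.
    split; [reflexivity|]; repeat split; auto.
Qed.

Lemma wr_inf_r R Q : wr (infR R Q) Q.
Proof.
  apply wr_total_intro with (K := bsnd) (H := fun u q => q = bcons 1 (bsnd u)).
  - recursive_op.
  - crel.
  - intros p (q & D1 & D2 & _); split; [assumption|].
    intros r Hr; exists (bcons 1 r); rewrite bsnd_bpair.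
    split; [reflexivity|]; repeat split; auto.
Qed.

Lemma wr_inf_glb R Q T : wr T R -> wr T Q -> wr T (infR R Q).
Proof.
  intros (H1 & K1 & HH1 & HK1 & spec1) (H2 & K2 & HH2 & HK2 & spec2).
  exists (fun u q => match bsnd u 0 with
      | 0 => H1 (bpair (bfst u) (btail (bsnd u))) q
      | S _ => H2 (bpair (bfst u) (btail (bsnd u))) q
      end),
    (fun p k => exists k1, K1 p k1 /\ exists k2, K2 p k2 /\ k = bpair k1 k2).
  split; [apply (@crel_if (fun u => bsnd u 0)); crel|split; [crel|]].
  intros p Dp.
  destruct (spec1 p Dp) as (k1 & Hk1 & [r1 Hr1] & R1).
  destruct (spec2 p Dp) as (k2 & Hk2 & [r2 Hr2] & R2).
  exists (bpair k1 k2); split; [eauto 6|split].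
  - exists (bcons 0 r1); unfold infR; rewrite bfst_bpair, bsnd_bpair.
    repeat split; [now exists r1 | now exists r2 | now left].
  - intros r (_ & _ & Hr); rewrite !bfst_bpair, !bsnd_bpair in *.
    destruct Hr as [(E & Hr)|(E & Hr)]; rewrite E; auto.
Qed.

(** The tag of a sum instance may come after arbitrarily many dummy symbols or never, so removing it
    is a partial computation that has to be lifted. *)
Lemma strip_exists :
  exists strip, recursive strip /\ forall p i q,
    minus1 (bproj i p) q -> minus1 (bproj i (strip p)) (btail q).
Proof.
  destruct (@crel_lift (fun u q => exists p',
      minus1 (bproj (u 0) (btail u)) p' /\ q = fun n => S (btail p' n)))
    as (L & L_rec & L_spec); [crel|].
  exists L; split; [assumption|]; intros p i q Hq.
  apply L_spec with (q := fun n => S (btail q n)); [|apply minus1_succ].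
  exists q; auto.
Qed.

(** A query must be produced even if the tag never arrives. So each stripped instance goes to both
    factors; once the tag is read, the answer of the right factor is taken, and the other query was
    harmless by totality. *)
Lemma wr_hb_sum_prod R Q : wr (hb (sumR R Q)) (prodR (hb R) (hb Q)).
Proof.
  destruct strip_exists as (strip & strip_rec & strip_spec).
  destruct (@crel_lift (fun u q => exists p',
      minus1 (bproj (u 0) (bfst (btail u))) p' /\ exists y,
      minus1 (fun n => match p' 0 with
                | 0 => bproj (u 0) (bfst (bsnd (btail u))) n
                | S _ => bproj (u 0) (bsnd (bsnd (btail u))) n
                end) y /\
      q = fun n => S (bcons (p' 0) y n)))
    as (L & L_rec & L_spec); [crel|].
  apply wr_total_intro with (K := fun p => bpair (strip p) (strip p))
    (H := fun u q => q = L u).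
  - recursive_op.
  - crel.
  - intros p _; split; [apply prodR_hb_total|].
    intros r [H1 H2]; rewrite bfst_bpair, bsnd_bpair in *.
    exists (L (bpair p r)); split; [reflexivity|].
    assert (HL : forall i p' y, minus1 (bproj i p) p' ->
      minus1 (match p' 0 with 0 => bproj i (bfst r) | S _ => bproj i (bsnd r) end) y ->
      minus1 (bproj i (L (bpair p r))) (bcons (p' 0) y)).
    { intros i p' y Hp' Hy.
      apply L_spec with (q := fun n => S (bcons (p' 0) y n)); [|apply minus1_succ].
      change (btail (bcons i (bpair p r))) with (bpair p r).
      rewrite bfst_bpair, bsnd_bpair.
      exists p'; split; [exact Hp'|]; exists y; split; [|reflexivity].
      cbn [bcons]; now destruct (p' 0). }
    intros i p' Hp' [q [(E & _ & Hq)|(E & _ & Hq)]].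
    + destruct (compl_apply (H1 i) (strip_spec _ _ _ Hp')) as (y & Hy & Ry);
        [now exists (btail q)|].
      exists (bcons (p' 0) y); split; [apply HL; [assumption | now rewrite E]|].
      rewrite E; left; auto.
    + destruct (compl_apply (H2 i) (strip_spec _ _ _ Hp')) as (y & Hy & Ry);
        [now exists (btail q)|].
      exists (bcons (p' 0) y); split; [apply HL; [assumption | now rewrite E]|].
      rewrite E; right; auto.
Qed.

Lemma minus1_bcons a p q : minus1 p q -> minus1 (bcons (S a) p) (bcons a q).
Proof.
  intros H [|k]; [now exists 1|].
  destruct (H k) as [n Hn]; exists (S n).
  replace (minus1_word (bcons (S a) p) (S n)) with (a :: minus1_word p n);
    [exact Hn|].
  unfold minus1_word; cbn; f_equal; rewrite <- seq_shift.
  now rewrite !flat_map_concat_map, map_map.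
Qed.

Lemma wr_prod_hb_sum R Q : wr (prodR (hb R) (hb Q)) (hb (sumR R Q)).
Proof.
  destruct strip_exists as (strip & strip_rec & strip_spec).
  (* Rows [0] and [1] hold the two given sequences, and later rows repeat row [1]. The leading [1]
     and [2] are the tags [0] and [1], shifted by one as symbols of completed names. *)
  set (K := fun p m => match pi2 m with
    | 0 => match pi1 (pi1 m) with 0 => 1 | S _ => 2 end
    | S n => match pi1 (pi1 m) with
             | 0 => bfst p (pr (pi2 (pi1 m)) n)
             | S _ => bsnd p (pr (pi2 (pi1 m)) n)
             end
    end).
  assert (K0 : forall p m, bproj (pr 0 m) (K p) = bcons 1 (bproj m (bfst p))).
  { intros p m; apply functional_extensionality; intro n; unfold bproj at 1, K.
    fold (pr (pr 0 m) n); rewrite pi1_pr, pi2_pr, pi1_pr, pi2_pr.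
    now destruct n. }
  assert (K1 : forall p m, bproj (pr 1 m) (K p) = bcons 2 (bproj m (bsnd p))).
  { intros p m; apply functional_extensionality; intro n; unfold bproj at 1, K.
    fold (pr (pr 1 m) n); rewrite pi1_pr, pi2_pr, pi1_pr, pi2_pr.
    now destruct n. }
  apply wr_total_intro with (K := K)
    (H := fun u q => exists v, v = strip (bsnd u) /\
       q = bpair (section 0 v) (section 1 v)).
  - unfold K; recursive_op.
  - apply (@crel_bind bsnd (fun u v => v = strip u)
      (fun _ v q => q = bpair (section 0 v) (section 1 v))); crel.
  - intros p _; split; [apply hb_total|].
    intros r Hr; eexists; rewrite bsnd_bpair; split; [eauto|].
    split; rewrite ?bfst_bpair, ?bsnd_bpair; intros m p' Hp' [q Hq];
      rewrite bproj_section.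
    + specialize (Hr (pr 0 m)); rewrite K0 in Hr.
      destruct (compl_apply Hr (minus1_bcons 0 Hp')) as (y & Hy & Ry).
      { exists (bcons 0 q); now left. }
      exists (btail y); split; [now apply strip_spec|].
      destruct Ry as [(_ & _ & Ry)|(E & _)]; [exact Ry | discriminate].
    + specialize (Hr (pr 1 m)); rewrite K1 in Hr.
      destruct (compl_apply Hr (minus1_bcons 1 Hp')) as (y & Hy & Ry).
      { exists (bcons 1 q); now right. }
      exists (btail y); split; [now apply strip_spec|].
      destruct Ry as [(E & _)|(_ & _ & Ry)]; [discriminate | exact Ry].
Qed.

(** * The implication and the residual law on names *)

Definition impR (phi : nat -> pfun baire baire) (G F : baire -> baire -> Prop)
    (p t : baire) : Prop :=
  exists n k q, t = btriple n k q /\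
    let A := mcomp (fun r s => phi n (bpair q r) s) (mcomp G (phi k)) p in
    (exists s, A s) /\ (forall s, A s -> F p s).

(** As [phi k] is single-valued, only one instance [u] of [G] is ever asked. The maximal domain of
    the composition then says that [phi n] succeeds on every answer to [u], and the inclusion in
    [F p] that each result is correct. *)
Lemma impRE phi G F p t :
  impR phi G F p t <->
  exists n k q u, t = btriple n k q /\ phi k p u /\ mdom G u /\
    forall r, G u r -> exists s, phi n (bpair q r) s /\ F p s.
Proof.
  split.
  - intros (n & k & q & -> & (s & (r & [(u & Hu & Hr) Du] & Hs) & Dr) & HA).
    exists n, k, q, u; repeat split; [assumption|now exists r|].
    intros r' Hr'; destruct (Dr r') as [s' Hs']; [split; eauto|].
    exists s'; split; [assumption|]; apply HA; split; [|assumption].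
    exists r'; split; [split; eauto | assumption].
  - intros (n & k & q & u & -> & Hu & [r Hr] & H); exists n, k, q.
    assert (E : forall r, mcomp G (phi k) p r -> G u r).
    { intros r' [(u' & Hu' & Hr') _].
      now rewrite (graph_fun Hu Hu'). }
    split; [reflexivity|split].
    + destruct (H r Hr) as (s & Hs & _); exists s; split.
      * exists r; split; [split; [eauto|] | assumption].
        intros u' Hu'; rewrite <- (graph_fun Hu Hu'); now exists r.
      * intros r' Hr'; destruct (H r' (E r' Hr')) as (s' & Hs' & _).
        now exists s'.
    + intros s [(r' & Hr' & Hs) _]; destruct (H r' (E r' Hr')) as (s' & Hs' & Fs).
      now rewrite (graph_fun Hs Hs').
Qed.

Lemma goedel_crel phi C :
  goedel_numbering phi -> crel C -> exists n, forall p q, C p q -> phi n p q.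
Proof.
  intros Hphi [c Hc]; destruct (gn_complete Hphi (code_fun_computable c)) as [n Hn].
  exists n; intros p q H; apply Hn; cbn; auto.
Qed.

Lemma goedel_universal phi :
  goedel_numbering phi -> crel (fun t q => phi (t 0) (btail t) q).
Proof. exact (@gn_utm phi). Qed.

(** The data of a solution may be uncomputable: it can store an answer [q] to [F] outright, with a
    program that ignores the reply to the dummy query [p]. *)
Lemma impR_hb_total phi G F p :
  goedel_numbering phi -> mdom (impR phi (hb G) (hb F)) p.
Proof.
  intro Hphi.
  destruct (@goedel_crel phi (fun u q => q = bfst u)) as [n Hn]; [assumption|crel|].
  destruct (@goedel_crel phi (fun u q => q = u)) as [k Hk];
    [assumption|apply (crel_recursive (f := fun u => u)); recursive_op|].
  destruct (hb_total F p) as [q Hq].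
  exists (btriple n k q); apply impRE; exists n, k, q, p.
  repeat split; [now apply Hk | apply hb_total |].
  intros r _; exists q; split; [|assumption].
  apply Hn; now rewrite bfst_bpair.
Qed.

Lemma wr_imp_of_prod phi F G H :
  goedel_numbering phi -> wr F (prodR (hb G) (hb H)) -> wr (impR phi (hb G) F) (hb H).
Proof.
  intros Hphi (D & K & HD & HK & spec).
  destruct (@goedel_crel phi (fun p u => exists k, K p k /\ u = bfst k)) as [k0 Hk0];
    [assumption|crel|].
  destruct (@goedel_crel phi (fun u s =>
    D (bpair (bfst (bfst u)) (bpair (bsnd u) (bsnd (bfst u)))) s)) as [n0 Hn0];
    [assumption|crel|].
  (* Both indices are constant; only the data [u], the pair of [p] and the answer of [H], varies. *)
  exists (fun u t => t = btriple n0 k0 u), (fun p u => exists k, K p k /\ u = bsnd k).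
  split; [unfold btriple; crel|split; [crel|]].
  intros p [t Ht]; apply impRE in Ht.
  (* A solution of the implication yields an answer to [F], so [p] lies in the domain of [F] and the
     hypothesis applies. *)
  destruct Ht as (n & k' & q & u & _ & _ & [r Hr] & Ht).
  destruct (Ht r Hr) as (s & _ & Hs).
  destruct (spec p (ex_intro _ s Hs)) as (k & Hk & _ & Rk).
  exists (bsnd k); split; [eauto|split; [apply hb_total|]].
  intros rh Hrh; eexists; split; [reflexivity|].
  apply impRE; exists n0, k0, (bpair p rh), (bfst k).
  repeat split; [apply Hk0; eauto | apply hb_total|].
  intros rg Hrg; destruct (Rk (bpair rg rh)) as (s' & Hs' & Fs').
  { split; now rewrite ?bfst_bpair, ?bsnd_bpair. }
  exists s'; split; [|assumption].
  apply Hn0; now rewrite !bfst_bpair, !bsnd_bpair.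
Qed.

(* The instance of [G] used by a solution of the implication depends on that
   solution only through an index [k], so all indices are tried in parallel. *)
Lemma wr_prod_of_imp phi F G H :
  goedel_numbering phi ->
  wr (impR phi (hb G) (hb F)) (hb H) -> wr F (prodR (hb G) (hb H)).
Proof.
  intros Hphi (D & K & HD & HK & spec).
  pose (U t s := phi (t 0) (btail t) s).
  assert (HU : crel U) by now apply goedel_universal.
  (* The implication concerns [hb F], so the instance [p] of [F] enters as a constant sequence of
     completed names. *)
  pose (const (p : baire) n := S (p (pi2 n))).
  assert (const_rec : recursive const) by (unfold const; recursive_op).
  destruct (@crel_lift (fun u q => exists s,
      U (bcons (pi1 (u 0)) (const (btail u))) s /\ q = bproj (pi2 (u 0)) s))
    as (L & L_rec & L_spec); [unfold const; crel|].
  (* The answer of [H] yields a triple [t]. Its second component selects the row of answers of [G],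
     its first component the program run on them together with the remaining data. *)
  exists (fun u q => exists t, D (bpair (const (bfst u)) (bsnd (bsnd u))) t /\
      exists s, U (bcons (t 0) (bpair (fun n => t (S (S n)))
        (section (t 1) (bfst (bsnd u))))) s /\
      minus1 (bproj 0 s) q),
    (fun p k => exists k', K (const p) k' /\ k = bpair (L p) k').
  split; [unfold const; crel|split; [crel|]].
  intros p Dp.
  destruct (spec (const p) (impR_hb_total G F (const p) Hphi))
    as (k' & Hk' & _ & Rk').
  exists (bpair (L p) k'); split; [eauto|split; [apply prodR_hb_total|]].
  intros r [Hrg Hrh]; rewrite ?bfst_bpair, ?bsnd_bpair in *.
  destruct (Rk' _ Hrh) as (t & Ht & It); apply impRE in It.
  destruct It as (n & k & q & u & -> & Hu & _ & It).
  destruct (It (section k (bfst r))) as (s & Hs & Fs).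
  { intro j; rewrite bproj_section.
    apply compl_weaken with (2 := Hrg (pr k j)).
    intros x Hx; apply L_spec with (q := bproj j u); [|assumption].
    exists u; cbn [bcons]; rewrite pi1_pr, pi2_pr; auto. }
  destruct (Fs 0 p) as (y & Hy & Fy); [|assumption|].
  { replace (bproj 0 (const p)) with (fun n => S (p n)); [apply minus1_succ|].
    apply functional_extensionality; intro m; unfold bproj, const.
    fold (pr 0 m); now rewrite pi2_pr. }
  exists y; split; [|assumption].
  exists (btriple n k q); split; [exact Ht|]; exists s; split; [exact Hs|exact Hy].
Qed.

(** * From problems to relations on names *)

Lemma relation_ext (A B : Type) (R Q : A -> B -> Prop) :
  (forall a b, R a b <-> Q a b) -> R = Q.
Proof.
  intro H; do 2 (apply functional_extensionality; intro).
  apply propositional_extensionality, H.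
Qed.

(** The domain conditions of both compositions are automatic: [p] names at most one point, and every
    point of the target has a name. *)
Lemma rproblemE f p q :
  rproblem f p q <->
  exists x y, delta (src f) p x /\ f x y /\ delta (tgt f) q y.
Proof.
  split.
  - intros [(y & [(x & Hx & Hy) _] & Hq) _]; exists x, y; auto.
  - intros (x & y & Hx & Hy & Hq); split.
    + exists y; split; [split|assumption].
      * exists x; auto.
      * intros x' Hx'; rewrite (graph_fun Hx' Hx); now exists y.
    + intros y' _; apply delta_surj.
Qed.

Lemma mdom_rproblem f p :
  mdom (rproblem f) p <-> exists x, delta (src f) p x /\ mdom f x.
Proof.
  split.
  - intros [q H]; apply rproblemE in H; destruct H as (x & y & Hx & Hy & _).
    exists x; split; [assumption | now exists y].
  - intros (x & Hx & y & Hy); destruct (delta_surj y) as [q Hq].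
    exists q; apply rproblemE; exists x, y; auto.
Qed.

Lemma completion_delta_total (X : repspace) p :
  exists x, delta (completion_space X) p x.
Proof.
  destruct (classic (exists a, wp_delta (X := X) p a)) as [[a Ha]|Hn].
  - now exists (Some a).
  - now exists None.
Qed.

(** Every sequence names a point of a completed space, so on names outside the domain both sides
    accept every [q]. *)
Lemma rproblem_completion f : rproblem (completion f) = compl (rproblem f).
Proof.
  apply relation_ext; intros p q; rewrite rproblemE; split.
  - intros (x & y & Hx & Hxy & Hy) p' Hp' Dp'.
    apply mdom_rproblem in Dp'; destruct Dp' as (a & Ha & Da).
    assert (Hxa : x = Some a).
    { apply (graph_fun Hx); exists p'; auto. }
    destruct (Hxy a Hxa Da) as (b & -> & Hab).
    destruct Hy as (q' & Hq' & Hb); exists q'; split; [assumption|].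
    apply rproblemE; exists a, b; auto.
  - intro H; destruct (completion_delta_total (src f) p) as [x Hx].
    destruct (classic (exists a, x = Some a /\ mdom f a)) as [(a & -> & Da)|Hn].
    + destruct Hx as (p' & Hp' & Ha).
      destruct (H p' Hp') as (q' & Hq' & Rq'); [apply mdom_rproblem; eauto|].
      apply rproblemE in Rq'; destruct Rq' as (a' & b & Ha' & Hab & Hb).
      rewrite (graph_fun Ha' Ha) in Hab.
      exists (Some a), (Some b); repeat split; [now exists p'| |now exists q'].
      intros a'' [= <-] _; now exists b.
    + destruct (completion_delta_total (tgt f) q) as [y Hy].
      exists x, y; repeat split; [assumption| |assumption].
      intros a Hxa Da; exfalso; eauto.
Qed.

Lemma rproblem_parallelization f :
  rproblem (parallelization f) = par (rproblem f).
Proof.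
  apply relation_ext; intros p q; rewrite rproblemE; split.
  - intros (x & y & Hx & Hxy & Hy) i; apply rproblemE.
    exists (x i), (y i); auto.
  - intro H.
    destruct (choice_fun (fun i => proj1 (rproblemE f _ _) (H i))) as [x Hx].
    destruct (choice_fun Hx) as [y Hy].
    exists x, y; repeat split; intro i; apply Hy.
Qed.

Lemma rproblem_hatbar f :
  rproblem (parallelization (completion f)) = hb (rproblem f).
Proof. now rewrite rproblem_parallelization, rproblem_completion. Qed.

Lemma rproblem_coproduct f g :
  rproblem (coproduct f g) = sumR (rproblem f) (rproblem g).
Proof.
  apply relation_ext; intros p q; unfold sumR; rewrite !rproblemE; split.
  - intros ([x|x] & [y|y] & [Ep Hx] & H & [Eq Hy]); try contradiction.
    + left; split; [assumption|split; [assumption|]]; exists x, y; auto.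
    + right; split; [assumption|split; [assumption|]]; exists x, y; auto.
  - intros [(Ep & Eq & x & y & Hx & H & Hy)|(Ep & Eq & x & y & Hx & H & Hy)].
    + exists (inl x), (inl y); cbn; auto.
    + exists (inr x), (inr y); cbn; auto.
Qed.

Lemma rproblem_inf f g :
  rproblem (inf_problem f g) = infR (rproblem f) (rproblem g).
Proof.
  apply relation_ext; intros p q; unfold infR.
  rewrite !mdom_rproblem, !rproblemE; split.
  - intros ([x u] & z & [Hx Hu] & (Df & Dg & H) & Hz); cbn in *.
    split; [now exists x|split; [now exists u|]].
    destruct z as [y|v], Hz as [Eq Hz]; [left|right]; (split; [exact Eq|]).
    + exists x, y; auto.
    + exists u, v; auto.
  - intros ((x & Hx & Df) & (u & Hu & Dg)
      & [(Eq & x' & y & Hx' & H & Hy)|(Eq & x' & y & Hx' & H & Hy)]).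
    + rewrite (graph_fun Hx' Hx) in H.
      exists (x, u), (inl y); repeat split; cbn; auto.
    + rewrite (graph_fun Hx' Hu) in H.
      exists (x, u), (inr y); repeat split; cbn; auto.
Qed.

Lemma rproblem_baire (R : baire -> baire -> Prop) :
  rproblem (@Problem baire_space baire_space R) = R.
Proof.
  apply relation_ext; intros p q; rewrite rproblemE; cbn; split.
  - intros (x & y & -> & H & ->); assumption.
  - intro H; exists p, q; auto.
Qed.

Lemma realizes_rproblem G f :
  realizes G f <->
  forall p, mdom (rproblem f) p -> exists q, G p q /\ rproblem f p q.
Proof.
  split.
  - intros H p Dp; apply mdom_rproblem in Dp; destruct Dp as (x & Hx & Dx).
    destruct (H p x Hx Dx) as (q & y & Hq & Hy & Hxy).
    exists q; split; [assumption|]; apply rproblemE; eauto.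
  - intros H p x Hx Dx.
    destruct (H p) as (q & Hq & R); [apply mdom_rproblem; eauto|].
    apply rproblemE in R; destruct R as (x' & y & Hx' & Hxy & Hy).
    rewrite (graph_fun Hx' Hx) in Hxy; eauto.
Qed.

(* Quantifying over realizers [G] amounts to quantifying over the possible
   answers at a single point: a realizer may be undefined outside of its
   required domain and can be modified at one point of it. *)
Lemma weihrauch_wr f g : weihrauch f g <-> wr (rproblem f) (rproblem g).
Proof.
  split.
  - intros (H & K & HH & HK & red); exists H, K.
    split; [exact HH|split; [exact HK|]]; intros p Dp.
    assert (Hs : forall k, exists r, mdom (rproblem g) k -> rproblem g k r).
    { intro k; destruct (classic (mdom (rproblem g) k)) as [[r Hr]|N].
      - now exists r.
      - now exists k. }
    apply choice_fun in Hs; destruct Hs as [s Hs].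
    (* The default answers [s] are overridden by the prescribed ones in [P]. Being undefined outside
       the domain of [g], this realizer forces every successful query into that domain. *)
    pose (G0 := fun (P : baire -> baire -> Prop) k r =>
      mdom (rproblem g) k /\ ((r = s k /\ ~ mdom P k) \/ P k r)).
    assert (G0_fun : forall P : baire -> baire -> Prop,
      (forall k r r', P k r -> P k r' -> r = r') ->
      forall k r r', G0 P k r -> G0 P k r' -> r = r').
    { intros P HP k r r' [Dk [[-> N]|Hr]] [Dk' [[-> N']|Hr']].
      - reflexivity.
      - exfalso; apply N; now exists r'.
      - exfalso; apply N'; now exists r.
      - eauto. }
    assert (G0_realizes : forall P HP,
      (forall k r, P k r -> rproblem g k r) ->
      realizes (PFun (G0_fun P HP)) g).
    { intros P HP HPg; apply realizes_rproblem; intros k Dk.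
      destruct (classic (mdom P k)) as [[r Hr]|N].
      - exists r; split; [split|]; auto.
      - exists (s k); split; [split|]; auto. }
    assert (answer : forall P HP, (forall k r, P k r -> rproblem g k r) ->
      exists q, reduction H K (PFun (G0_fun P HP)) p q /\ rproblem f p q).
    { intros P HP HPg.
      apply (proj1 (realizes_rproblem _ f) (red _ (G0_realizes P HP HPg)) p Dp). }
    (* Without prescribed answers, the run reveals the query [k] and that it is proper. *)
    destruct (answer (fun _ _ => False) (fun _ _ _ H _ => match H with end)
      (fun _ _ H => match H with end)) as (q & (k & r & Hk & [Dk _] & _) & _).
    exists k; split; [assumption|split; [assumption|]]; intros r' Hr'.
    (* Prescribing [r'] at [k] leaves the query unchanged, as [K] does not depend on the
       realizer. *)
    unshelve edestruct (answer (fun a b => a = k /\ b = r'))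
      as (q' & (k' & r'' & Hk' & [Dk' Hr''] & Hq') & Rq').
    { intros ? ? ? [_ ->] [_ ->]; reflexivity. }
    { intros ? ? [-> ->]; assumption. }
    rewrite (graph_fun Hk' Hk) in *.
    destruct Hr'' as [[_ N]|[_ ->]]; [exfalso; apply N; now exists r'|].
    exists q'; auto.
  - intros (H & K & [h HH] & [k HK] & spec).
    exists (code_fun h), (code_fun k).
    split; [apply code_fun_computable|split; [apply code_fun_computable|]].
    intros G HG; apply realizes_rproblem; intros p Dp.
    destruct (spec p Dp) as (u & Hu & Du & Ru).
    destruct (proj1 (realizes_rproblem G g) HG u Du) as (r & Hr & Rr).
    destruct (Ru r Rr) as (q & Hq & Rq).
    exists q; split; [|assumption].
    exists u, r; split; [exact (HK _ _ Hu)|split; [assumption|exact (HH _ _ Hq)]].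
Qed.

Lemma le_ptW_Some f g :
  le_ptW (Some f) (Some g) <-> wr (rproblem f) (hb (rproblem g)).
Proof. rewrite <- rproblem_hatbar; apply weihrauch_wr. Qed.

Lemma le_ptW_None_r f : le_ptW f None.
Proof. now destruct f. Qed.

Lemma le_ptW_refl f : le_ptW f f.
Proof.
  destruct f as [f|]; [|exact I]; apply le_ptW_Some, wr_hb_r.
Qed.

Lemma le_ptW_trans f g h : le_ptW f g -> le_ptW g h -> le_ptW f h.
Proof.
  destruct h as [h|]; [|intros; apply le_ptW_None_r].
  destruct g as [g|]; [|intros _ []].
  destruct f as [f|]; [|intros []].
  rewrite !le_ptW_Some; apply wr_hb_trans.
Qed.

Lemma ptW_inf_l f g : le_ptW (ptW_inf f g) f.
Proof.
  destruct f as [f|]; [|apply le_ptW_None_r].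
  destruct g as [g|]; apply le_ptW_Some.
  - rewrite rproblem_inf, !rproblem_hatbar; apply wr_inf_l.
  - rewrite rproblem_hatbar; apply wr_refl.
Qed.

Lemma ptW_inf_r f g : le_ptW (ptW_inf f g) g.
Proof.
  destruct g as [g|]; [|apply le_ptW_None_r].
  destruct f as [f|]; apply le_ptW_Some.
  - rewrite rproblem_inf, !rproblem_hatbar; apply wr_inf_r.
  - rewrite rproblem_hatbar; apply wr_refl.
Qed.

Lemma ptW_inf_glb f g h : le_ptW h f -> le_ptW h g -> le_ptW h (ptW_inf f g).
Proof.
  destruct h as [h|].
  - destruct f as [f|], g as [g|]; cbn [ptW_inf hatbar ecompletion eparallelization option_map einf];
      try (intros; apply le_ptW_None_r).
    all: intros Hf Hg; apply le_ptW_Some; eapply wr_trans; [|apply wr_hb_r].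
    all: rewrite ?rproblem_inf, ?rproblem_hatbar.
    + apply wr_inf_glb; now apply le_ptW_Some.
    + now apply le_ptW_Some.
    + now apply le_ptW_Some.
  - destruct f as [f|], g as [g|]; now cbn.
Qed.

Lemma esup_l f g : le_ptW f (esup f g).
Proof.
  destruct f as [f|], g as [g|]; try apply le_ptW_None_r.
  apply le_ptW_Some; rewrite rproblem_coproduct.
  eapply wr_trans; [apply wr_sum_l | apply wr_hb_r].
Qed.

Lemma esup_r f g : le_ptW g (esup f g).
Proof.
  destruct f as [f|], g as [g|]; try apply le_ptW_None_r.
  apply le_ptW_Some; rewrite rproblem_coproduct.
  eapply wr_trans; [apply wr_sum_r | apply wr_hb_r].
Qed.

Lemma esup_lub f g h : le_ptW f h -> le_ptW g h -> le_ptW (esup f g) h.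
Proof.
  destruct h as [h|]; [|intros; apply le_ptW_None_r].
  destruct f as [f|]; [|intros []].
  destruct g as [g|]; [|intros _ []].
  cbn [esup]; rewrite !le_ptW_Some, rproblem_coproduct; apply wr_sum_lub.
Qed.

Lemma one_le_ptW f : le_ptW (Some one) f.
Proof.
  destruct f as [f|]; [|exact I]; apply le_ptW_Some.
  unfold one; rewrite rproblem_baire.
  apply wr_total_intro with (K := fun p => p) (H := fun u q => q = bfst u).
  - recursive_op.
  - crel.
  - intros p _; split; [apply hb_total|]; intros r _; exists p.
    now rewrite bfst_bpair.
Qed.

(** The exceptional clause for a first argument with empty domain never applies, because [hb] is
    total on names. *)
Lemma ptW_imp_Some phi g f :
  ptW_imp phi (Some g) (Some f) =
  Some (mul_imp_problem phi (parallelization (completion g))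
          (parallelization (completion f))).
Proof.
  cbn; destruct (excluded_middle_informative _) as [H|H]; [reflexivity|].
  exfalso; apply H; left.
  destruct (proj1 (mdom_rproblem (parallelization (completion g)) (fun _ => 0)))
    as (x & _ & Dx); [rewrite rproblem_hatbar; apply hb_total | now exists x].
Qed.

Lemma ptW_imp_residual phi f g h :
  goedel_numbering phi ->
  (le_ptW (ptW_imp phi g f) h <-> le_ptW f (esup g h)).
Proof.
  intro Hphi; destruct h as [h|].
  2: { split; intros _; [destruct g|]; apply le_ptW_None_r. }
  destruct g as [g|].
  (* For [g] the top element the implication is [zero], which lies below everything. *)
  2: { split; intros _; [apply le_ptW_None_r|]; apply le_ptW_Some.
       unfold zero; rewrite rproblem_baire.
       apply wr_total_intro with (K := fun p => p) (H := fun u q => q = u).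
       - recursive_op.
       - crel.
       - intros p [q []]. }
  (* For [f] the top element both sides place it below a proper problem and are false. *)
  destruct f as [f|]; [|now split].
  rewrite ptW_imp_Some; cbn [esup]; rewrite !le_ptW_Some.
  unfold mul_imp_problem; rewrite rproblem_baire, rproblem_coproduct.
  change (mul_imp_rel phi ?a ?b) with (impR phi (rproblem a) (rproblem b)).
  rewrite !rproblem_hatbar; split; intro H.
  - apply wr_trans with (2 := wr_prod_hb_sum _ _).
    now apply wr_prod_of_imp with phi.
  - apply wr_imp_of_prod; [assumption|].
    apply wr_trans with (2 := wr_hb_sum_prod _ _).
    now apply wr_hb.
Qed.

(** * Degrees *)

Lemma cls_le f g : deg_le (cls f) (cls g) <-> le_ptW f g.
Proof.
  split.
  - intros (f' & g' & [Hf _] & [_ Hg] & H).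
    exact (le_ptW_trans Hf (le_ptW_trans H Hg)).
  - intro H; exists f, g; repeat split; try apply le_ptW_refl; assumption.
Qed.

Lemma cls_eq f g : equiv_ptW f g -> cls f = cls g.
Proof.
  intros [Hfg Hgf]; apply subset_eq_compat.
  apply functional_extensionality; intro h.
  apply propositional_extensionality; split; intros [H H']; split;
    eauto using le_ptW_trans.
Qed.

Lemma W_ptW_ind (P : W_ptW -> Prop) : (forall f, P (cls f)) -> forall a, P a.
Proof.
  intros H [C HC].
  assert (E : exists f, exist _ C HC = cls f).
  { destruct HC as [f Hf]; exists f; now apply subset_eq_compat. }
  destruct E as [f ->]; apply H.
Qed.

(** The operation is applied to chosen representatives. One inequality in the hypothesis suffices,
    since equivalence is symmetric. *)
Lemma induced_exists op :
  (forall f f' g g', equiv_ptW f f' -> equiv_ptW g g' ->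
     le_ptW (op f g) (op f' g')) ->
  exists op', induced op' op.
Proof.
  intro Hop.
  destruct (choice_fun (W_ptW_ind (P := fun a => exists f, a = cls f)
    (fun f => ex_intro _ f eq_refl))) as [rep Hrep].
  exists (fun a b => cls (op (rep a) (rep b))); intros f g.
  assert (E : forall f, equiv_ptW (rep (cls f)) f /\ equiv_ptW f (rep (cls f))).
  { intro h; assert (H := Hrep (cls h)).
    assert (le_ptW h (rep (cls h)) /\ le_ptW (rep (cls h)) h)
      by (rewrite <- !cls_le, <- H, !cls_le; split; apply le_ptW_refl).
    unfold equiv_ptW; tauto. }
  apply cls_eq; split; apply Hop; apply E.
Qed.

Theorem theorem8p5 (phi : nat -> pfun baire baire) (Hphi : goedel_numbering phi) :
  (forall f g : eproblem, deg_le (cls f) (cls g) <-> le_ptW f g) /\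
  exists meet join imp : W_ptW -> W_ptW -> W_ptW,
    induced meet ptW_inf /\
    induced join esup /\
    induced imp (ptW_imp phi) /\
    brouwer_algebra deg_le meet join imp (cls (Some one)) (cls infty).
Proof.
  split; [exact cls_le|].
  assert (residual := fun f g h => @ptW_imp_residual phi f g h Hphi).
  assert (inf_mono : forall f f' g g', le_ptW f f' -> le_ptW g g' ->
    le_ptW (ptW_inf f g) (ptW_inf f' g')).
  { intros; apply ptW_inf_glb; eauto using le_ptW_trans, ptW_inf_l, ptW_inf_r. }
  assert (sup_mono : forall f f' g g', le_ptW f f' -> le_ptW g g' ->
    le_ptW (esup f g) (esup f' g')).
  { intros; apply esup_lub; eauto using le_ptW_trans, esup_l, esup_r. }
  assert (imp_mono : forall g g' f f', le_ptW g' g -> le_ptW f f' ->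
    le_ptW (ptW_imp phi g f) (ptW_imp phi g' f')).
  (* The residual law applied to the trivial inequality of the implication from [g'] to [f'] with
     itself bounds [f'] by the join of [g'] and that implication; enlarging [g'] to [g] and
     shrinking [f'] to [f] preserves the bound. *)
  { intros g g' f f' Hg Hf; apply residual.
    apply le_ptW_trans with (1 := Hf), le_ptW_trans with (esup g' (ptW_imp phi g' f')).
    - apply residual, le_ptW_refl.
    - apply sup_mono; [assumption | apply le_ptW_refl]. }
  destruct (@induced_exists ptW_inf) as [meet Hmeet].
  { intros f f' g g' [] []; now apply inf_mono. }
  destruct (@induced_exists esup) as [join Hjoin].
  { intros f f' g g' [] []; now apply sup_mono. }
  destruct (@induced_exists (ptW_imp phi)) as [imp Himp].
  { intros f f' g g' [] []; now apply imp_mono. }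
  exists meet, join, imp; repeat (split; [assumption|]); split;
    repeat (intro a; pattern a; revert a; apply W_ptW_ind; intro);
    rewrite ?Hmeet, ?Hjoin, ?Himp, ?cls_le.
  - apply le_ptW_refl.
  - apply le_ptW_trans.
  - intros; now apply cls_eq.
  - apply ptW_inf_l.
  - apply ptW_inf_r.
  - apply ptW_inf_glb.
  - apply esup_l.
  - apply esup_r.
  - apply esup_lub.
  - apply one_le_ptW.
  - apply le_ptW_None_r.
  - intro; apply imp_mono; [apply le_ptW_refl | assumption].
  - intro; apply imp_mono; [assumption | apply le_ptW_refl].
  - apply residual.
Qed.
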